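(* Let $0<\delta_0<1$ and let $A=\left\{p\in\mathbb{P}: \frac{p_1p_2}{p}-\left\lfloor\frac{p_1p_2}{p}\right\rfloor<\delta_0\right\}$. If $A$ is infinite, then $Y_{p,2}\in N_1$ for all but finitely many $p\in A$.
   Context: $\mathbb{P}$ is the set of primes; for a prime $p$, $p_i$ denotes the $i$th smallest prime greater than $p$, and $Y_{p,2}=\prod_{q\text{ prime},\ q\le p_2,\ q\ne p}q$. $\phi$ is Euler's totient function, $V$ its image; for $m\in V$, $N_1(m)=\max\{x\in\mathbb{N}:\phi(x)\le m\}$, $N_1=\{N_1(m):m\in V\}$. *)

(* Defs.v *)
From HB Require Import structures.
From mathcomp Require Import all_boot all_order all_algebra.
From mathcomp Require Import boolp classical_sets cardinality reals.

Set Implicit Arguments.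
Unset Strict Implicit.
Unset Printing Implicit Defensive.

Import Order.TTheory GRing.Theory Num.Theory.

Local Open Scope classical_set_scope.

Lemma ex_next_prime (n : nat) : exists q, (n < q) && prime q.
Proof. by have [q ltnq pq] := prime_above n; exists q; rewrite ltnq. Qed.

Definition next_prime (n : nat) : nat := ex_minn (ex_next_prime n).

(* p_i, the i-th smallest prime greater than p (so [prime_after p 0 = p]) *)
Definition prime_after (p i : nat) : nat := iter i next_prime p.

Definition Y2 (p : nat) : nat :=
  (\prod_(q < (prime_after p 2).+1 | prime q && (q != p :> nat)) q)%N.

(* Arguments of the totient function are restricted to positive integers,
   because [totient 0 = 0] in the library. *)
Definition V : set nat := totient @` [set x | 0 < x].

Definition is_max (E : set nat) (x : nat) : Prop :=
  E x /\ forall y, E y -> y <= x.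

(* The default value 0 of [xget] is never reached for m in V: see [N1P]. *)
Definition N1 (m : nat) : nat :=
  xget 0 (is_max [set x | 0 < x /\ totient x <= m]).

Definition N1set : set nat := N1 @` V.

Local Open Scope ring_scope.

Definition frac_part (R : realType) (x : R) : R := x - (Num.floor x)%:~R.

Definition frac_primes (R : realType) (delta0 : R) : set nat :=
  [set p | prime p /\
     frac_part ((prime_after p 1 * prime_after p 2)%N%:R / p%:R) < delta0].

Local Close Scope ring_scope.

Lemma odd_leq_totient_sqr n : odd n -> n <= totient n ^ 2.
Proof.
elim/ltn_ind: n => n IH on.
have n0 : 0 < n by case: n on {IH}.
have [n1|n1] := leqP n 1; first by have -> : n = 1 by apply/eqP; rewrite eqn_leq n1.
have pp := pdiv_prime n1; set p := pdiv n in pp.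
have [k ckp nE] := pfactor_coprime pp n0.
have e0 : 0 < logn p n by rewrite logn_gt0 mem_primes pp n0 pdiv_dvd.
move: e0 nE; case: (logn p n) => // e _ nE.
have := on; rewrite nE oddM oddX /= => /andP[ok op].
have p3 : 2 < p by rewrite ltn_neqAle prime_gt1 // andbT; apply: contraL op => /eqP <-.
have kn : k < n.
  rewrite nE -[X in X < _]muln1 ltn_pmul2l; last by case: (k) ok.
  by rewrite -(exp1n e.+1) ltn_exp2r // prime_gt1.
rewrite totient_coprime; last by rewrite coprimeXr // coprime_sym.
rewrite totient_pfactor // expnMn leq_mul ?IH //=.
rewrite expnS expnMn leq_mul //.
  by case: (p) p3 => [|[|[|q]]] // _; rewrite /= -mulnn mulSn -[X in X < _]addn0 ltn_add2l.
by rewrite -expnM leq_exp2l ?prime_gt1// leq_pmulr.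
Qed.

Lemma leq_totient_sqr n : 0 < n -> n <= 2 * totient n ^ 2.
Proof.
move=> n0; have [k ck nE] := pfactor_coprime (isT : prime 2) n0.
have := odd_leq_totient_sqr (n := k); rewrite -coprime2n => /(_ ck) kle.
move: nE; case: (logn 2 n) => [|e] nE.
  by rewrite nE muln1 (leq_trans kle) // leq_pmull.
rewrite {}nE totient_coprime; last by rewrite coprimeXr // coprime_sym.
rewrite totient_pfactor //= mul1n expnMn mulnCA leq_mul //.
by rewrite expnS leq_mul // -expnM leq_exp2l // leq_pmulr.
Qed.

Lemma N1P m : V m -> is_max [set x | 0 < x /\ totient x <= m] (N1 m).
Proof.
move=> [x x0 xm]; apply: xgetPex.
pose P := [pred y | (0 < y) && (totient y <= m)].
have exP : exists y, P y by exists x; rewrite /= x0 xm leqnn.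
have ubP y : P y -> y <= 2 * m ^ 2.
  by case/andP=> /leq_totient_sqr yle ym; rewrite (leq_trans yle) // leq_mul // leq_exp2r.
case: (ex_maxnP exP ubP) => y /andP[y0 ym] ymax; exists y; split=> // z [z0 zm].
by apply: ymax; rewrite /= z0.
Qed.

(* Main.v *)
Require Import Defs.
From HB Require Import structures.
From mathcomp Require Import all_boot all_order all_algebra.
From mathcomp Require Import boolp classical_sets cardinality reals.
From mathcomp Require Import sequences exp ring lra zify.

(** Suppose x > Y = Y_{p,2} but phi(x) <= phi(Y). Cancelling common primes, x
    trades a set U of primes of Y for a set W of other primes, and comparing
    products with the pivot p_2 kills every trade except {p_1, p_2} for {p, r}.
    For that one, r lies in an interval of length
    (p_1 - p)(p_2 - p) / (p (p - 1)) to the right of p_1 p_2 / p, and this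
    contains no integer once the length is at most 1 - delta_0.

    So one needs p_2 - p = o(p). This is derived as Erdos did from Selberg's
    formula. By that formula the mass Lambda(n)/n has at most twice its mean
    density on (x, e^h x], and if (x, e^h x] is nearly empty then for almost
    all prime powers n the interval (x/n, e^h x/n] has density almost 2. If h
    is such that nearly empty intervals of logarithmic length h occur but none
    of length 1.1 h, then these double-density intervals cover long ranges
    almost completely, contradicting Mertens' estimate. Hence h can be
    replaced by 1.1 h, which Mertens' estimate does not allow forever. *)

Set Implicit Arguments.
Unset Strict Implicit.
Unset Printing Implicit Defensive.

Import Order.TTheory GRing.Theory Num.Theory.
Local Open Scope ring_scope.

(** * Divisor sums, the functions of von Mangoldt and Moebius *)

Section DivisorSums.
Variable M : nmodType.

Lemma sum_divisors (N n : nat) (F : nat -> M) : (0 < n <= N)%N ->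
  \sum_(d <- divisors n) F d = \sum_(1 <= d < N.+1 | (d %| n)%N) F d.
Proof.
case/andP=> n0 nN; rewrite -[RHS]big_filter; apply: perm_big; apply: uniq_perm.
- exact: divisors_uniq.
- exact/filter_uniq/iota_uniq.
move=> d; rewrite mem_filter mem_index_iota -dvdn_divisors //.
case: (boolP (d %| n)%N) => //= dn; rewrite ltnS (dvdn_gt0 n0 dn) /=.
by rewrite (leq_trans (dvdn_leq n0 dn)).
Qed.

Lemma sum_multiples (N d : nat) (F : nat -> M) : (0 < d)%N ->
  \sum_(1 <= k < N.+1 | (d %| k)%N) F k = \sum_(1 <= m < (N %/ d).+1) F (d * m)%N.
Proof.
move=> d0; rewrite -big_filter -(big_map (muln d) predT F); apply: perm_big.
apply: uniq_perm.
- exact/filter_uniq/iota_uniq.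
- by rewrite map_inj_uniq ?iota_uniq // => a b /eqP; rewrite eqn_pmul2l // => /eqP.
move=> k; rewrite mem_filter mem_index_iota; apply/andP/mapP.
  case=> /dvdnP[m ->] /andP[m0 mN]; exists m; last by rewrite mulnC.
  by rewrite mem_index_iota ltnS leq_divRL //; move: m0 mN; rewrite muln_gt0; lia.
case=> m; rewrite mem_index_iota ltnS => /andP[m0]; rewrite leq_divRL // => mN ->.
by rewrite dvdn_mulr // ltnS muln_gt0 d0 m0 mulnC.
Qed.

Lemma sum_divisors_exchange (N : nat) (g : nat -> nat -> M) :
  \sum_(1 <= k < N.+1) \sum_(d <- divisors k) g d k =
  \sum_(1 <= d < N.+1) \sum_(1 <= m < (N %/ d).+1) g d (d * m)%N.
Proof.
under eq_big_nat => k kN.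
  rewrite (@sum_divisors N) // big_mkcond /=; over.
rewrite exchange_big /=; apply: eq_big_nat => d /andP[d0 _].
by rewrite -big_mkcond (sum_multiples _ _ d0).
Qed.

Lemma sum_divisors_swap (n : nat) (g : nat -> nat -> M) : (0 < n)%N ->
  \sum_(d <- divisors n) \sum_(e <- divisors (n %/ d)) g d e =
  \sum_(e <- divisors n) \sum_(d <- divisors (n %/ e)) g d e.
Proof.
move=> n0.
have E (f : nat -> nat -> M) :
    \sum_(d <- divisors n) \sum_(e <- divisors (n %/ d)) f d e =
    \sum_(1 <= d < n.+1) \sum_(1 <= e < n.+1) (if (d * e %| n)%N then f d e else 0).
  rewrite (@sum_divisors n) ?n0 ?leqnn // big_mkcond; apply: eq_big_nat => d /andP[d0 _].
  case: ifP => dn; last first.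
    rewrite big1 // => e _; case: ifP => // den.
    by rewrite (dvdn_trans (dvdn_mulr e (dvdnn d)) den) in dn.
  rewrite (@sum_divisors n); last first.
    by rewrite divn_gt0 // dvdn_leq //= leq_div.
  by rewrite big_mkcond; apply: eq_bigr => e _; rewrite dvdn_divRL // mulnC.
rewrite E (E (fun e d => g d e)) exchange_big /=.
by apply: eq_bigr => i _; apply: eq_bigr => j _; rewrite mulnC.
Qed.

End DivisorSums.

Section ArithmeticFunctions.
Variable R : realType.
Implicit Types n p d : nat.

Definition vonMangoldt n : R := if primes n is [:: p] then ln p%:R else 0.

Definition moebius n : R := \prod_(p <- primes n) (if logn p n == 1%N then -1 else 0).

Lemma vonMangoldt1 : vonMangoldt 1 = 0. Proof. by []. Qed.

Lemma vonMangoldt_ge0 n : 0 <= vonMangoldt n.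
Proof.
rewrite /vonMangoldt; case E: (primes n) => [|p [|q s]] //.
have : p \in primes n by rewrite E inE.
by rewrite mem_primes => /and3P[/prime_gt0 p0 _ _]; rewrite ln_ge0 // ler1n.
Qed.

Lemma primes1_pfactor n p : primes n = [:: p] -> prime p /\ n = (p ^ logn p n)%N.
Proof.
move=> E; have : p \in primes n by rewrite E inE.
rewrite mem_primes => /and3P[pp n0 _]; split=> //.
by rewrite {1}(prod_prime_decomp n0) prime_decompE E /= big_seq1.
Qed.

Lemma vonMangoldt_pfactor p k : prime p -> vonMangoldt (p ^ k.+1) = ln p%:R.
Proof. by move=> pp; rewrite /vonMangoldt primesX // primes_prime. Qed.

(** Induction on n = m p with p prime. With e the exponent of p in m, the only prime power dividing
    n but not m is p^(e+1), which contributes ln p. *)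
Lemma sum_vonMangoldt n : (0 < n)%N ->
  \sum_(d <- divisors n) vonMangoldt d = ln n%:R.
Proof.
elim/ltn_ind: n => n IH n0.
have [n1|n1] := leqP n 1.
  have -> : n = 1%N by lia.
  by rewrite (_ : divisors 1 = [:: 1%N]) // big_seq1 ln1.
have [p pp /dvdnP[m nE]] : exists2 p, prime p & (p %| n)%N.
  by exists (pdiv n); rewrite ?pdiv_prime ?pdiv_dvd.
have p0 := prime_gt0 pp; have m0 : (0 < m)%N by move: n0; rewrite nE; case: (m).
have mn : (m < n)%N by rewrite nE ltn_Pmulr // prime_gt1.
have -> : ln n%:R = ln m%:R + ln p%:R :> R.
  by rewrite nE natrM lnM ?posrE ?ltr0n ?m0 ?p0.
rewrite -(IH m) //.
rewrite (bigID (fun d => (d %| m)%N)) /=; congr (_ + _).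
  rewrite -big_filter; apply: perm_big; apply: uniq_perm => [||d].
  - exact/filter_uniq/divisors_uniq.
  - exact: divisors_uniq.
  rewrite mem_filter -!dvdn_divisors //.
  by case: (boolP (d %| m)%N) => //= dm; rewrite nE dvdn_mulr.
set e := logn p m.
have pe : (p ^ e.+1)%N \in divisors n.
  by rewrite -dvdn_divisors // nE pfactor_dvdn ?muln_gt0 ?m0 // lognM // (logn_prime p pp) eqxx addn1.
rewrite -big_filter (bigD1_seq (p ^ e.+1)%N) /=; last first.
- exact/filter_uniq/divisors_uniq.
- by rewrite mem_filter pe pfactor_dvdn // ltnn.
rewrite vonMangoldt_pfactor // big_seq_cond big1 ?addr0 // => d.
rewrite mem_filter -dvdn_divisors // => /andP[/andP[dm dn] dpe].
rewrite /vonMangoldt; case E: (primes d) => [|q [|r s]] //.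
have [pq dE] := primes1_pfactor E.
have [qp|qp] := eqVneq q p.
  exfalso; move: dm dn dpe; rewrite dE qp nE !pfactor_dvdn ?muln_gt0 ?m0 //.
  rewrite lognM // (logn_prime p pp) eqxx -/e => h1 h2.
  by rewrite (_ : logn p d = e.+1) ?eqxx //; lia.
case/negP: dm; rewrite dE -(@Gauss_dvdl _ _ p); first by rewrite -dE -nE.
by apply: coprimeXl; rewrite prime_coprime // dvdn_prime2.
Qed.

Lemma normr_moebius_le1 n : `|moebius n| <= 1.
Proof.
rewrite /moebius; apply: (big_ind (fun x : R => `|x| <= 1)) => [|x y x1 y1|p _].
- by rewrite normr1.
- by rewrite normrM mulr_ile1.
by case: ifP; rewrite ?normrN ?normr1 ?normr0 ?ler01.
Qed.

Lemma moebiusM_prime p n : prime p -> (0 < n)%N ->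
  moebius (p * n) = if (p %| n)%N then 0 else - moebius n.
Proof.
move=> pp n0; have p0 := prime_gt0 pp; have pn0 : (0 < p * n)%N by rewrite muln_gt0 p0.
case: (boolP (p %| n)%N) => pn.
  rewrite /moebius (bigD1_seq p) ?primes_uniq //=; last first.
    by rewrite mem_primes pp pn0 dvdn_mulr.
  rewrite lognM // (logn_prime p pp) eqxx add1n eqSS.
  have : (0 < logn p n)%N by rewrite logn_gt0 mem_primes pp n0.
  by case: (logn p n) => // k _; rewrite mul0r.
have P : perm_eq (primes (p * n)) (p :: primes n).
  apply: uniq_perm; rewrite /= ?primes_uniq ?mem_primes ?(negPf pn) ?andbF //.
  move=> q; rewrite primesM // !inE; congr (_ || _).
  by rewrite primes_prime // inE.
rewrite /moebius (perm_big _ P) big_cons /= lognM // (logn_prime p pp) eqxx.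
rewrite (_ : logn p n = 0%N); last by apply/eqP; rewrite -leqn0 leqNgt logn_gt0 mem_primes pp n0.
rewrite addn0 eqxx mulN1r; congr (- _); apply: eq_big_seq => q.
rewrite mem_primes => /and3P[pq _ qn]; rewrite lognM // (logn_prime q pp).
by rewrite (_ : (q == p) = false) //; apply/eqP => qp; rewrite -qp qn in pn.
Qed.

(** For n = p m with p prime, the divisors p k with k | m contribute -mu(k) if p does not divide k
    and 0 otherwise. This cancels the divisors of n prime to p, which are those of m prime to p. *)
Lemma sum_moebius n : (0 < n)%N -> \sum_(d <- divisors n) moebius d = (n == 1%N)%:R.
Proof.
move=> n0; have [n1|n1] := leqP n 1.
  have -> : n = 1%N by lia.
  by rewrite (_ : divisors 1 = [:: 1%N]) // big_seq1 /moebius (_ : primes 1 = [::]) // big_nil.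
rewrite gtn_eqF //; have [p pp /dvdnP[m nE]] : exists2 p, prime p & (p %| n)%N.
  by exists (pdiv n); rewrite ?pdiv_prime ?pdiv_dvd.
have p0 := prime_gt0 pp.
have m0 : (0 < m)%N by move: n0; rewrite nE; case: (m).
rewrite (@sum_divisors _ n) ?n0 ?leqnn // (bigID (fun d => p %| d)%N) /=.
rewrite big_mkcondl /= (sum_multiples n (fun k => if (k %| n)%N then moebius k else 0)) //.
have -> : (n %/ p = m)%N by rewrite nE mulnK.
under eq_big_nat => k /andP[k0 _].
  rewrite moebiusM_prime // {1}nE mulnC dvdn_pmul2r //; over.
rewrite -big_mkcond /= (eq_bigr (fun k => - (if (p %| k)%N then 0 else moebius k))); last first.
  by move=> k _; case: ifP; rewrite ?oppr0.
rewrite sumrN; apply/eqP; rewrite addrC subr_eq0; apply/eqP.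
rewrite [RHS](eq_bigr (fun k => if ~~ (p %| k)%N then moebius k else 0)); last first.
  by move=> k _; case: ifP.
rewrite -[RHS]big_mkcondr /= -[RHS]big_filter -[LHS]big_filter; apply: perm_big.
apply: uniq_perm; [exact/filter_uniq/iota_uniq|exact/filter_uniq/iota_uniq|] => d.
rewrite !mem_filter !mem_index_iota.
case: (boolP (p %| d)%N) => pd; rewrite /= ?andbF //= !andbT.
have -> : (d %| n)%N = (d %| m)%N.
  by rewrite nE Gauss_dvdl // coprime_sym prime_coprime.
case: (boolP (d %| m)%N) => //= dm.
have := dvdn_leq m0 dm; have : (m <= n)%N by rewrite nE leq_pmulr.
lia.
Qed.

(** Moebius inversion of [sum_vonMangoldt] shows that mu(d) ln(n/d) sums to Lambda(n), and mu(d) ln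
    n sums to 0 for every n. *)
Lemma sum_moebius_ln n : (0 < n)%N ->
  \sum_(d <- divisors n) moebius d * ln d%:R = - vonMangoldt n.
Proof.
move=> n0.
have E : \sum_(d <- divisors n) moebius d * ln (n %/ d)%:R = vonMangoldt n.
  rewrite (eq_big_seq (fun d => \sum_(e <- divisors (n %/ d)) moebius d * vonMangoldt e)).
    rewrite sum_divisors_swap // (bigD1_seq n) ?divisors_uniq ?divisors_id //=.
    rewrite divnn n0 (_ : divisors 1 = [:: 1%N]) // big_seq1.
    rewrite {1}/moebius (_ : primes 1 = [::]) // big_nil mul1r.
    rewrite big_seq_cond big1 ?addr0 // => e; rewrite -dvdn_divisors // => /andP[en en1].
    have e0 := dvdn_gt0 n0 en.
    have ne0 : (0 < n %/ e)%N by rewrite divn_gt0 // dvdn_leq.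
    rewrite -mulr_suml (sum_moebius ne0).
    have /negPf -> : (n %/ e != 1)%N by apply: contraNN en1 => /eqP h; rewrite -(divnK en) h mul1n.
    by rewrite mul0r.
  move=> d; rewrite -dvdn_divisors // => dn.
  have nd0 : (0 < n %/ d)%N by rewrite divn_gt0 ?(dvdn_gt0 n0 dn) // dvdn_leq.
  by rewrite -mulr_sumr (sum_vonMangoldt nd0).
rewrite -E -sumrN.
have [n1|n1] := leqP n 1.
  have -> : n = 1%N by lia.
  by rewrite (_ : divisors 1 = [:: 1%N]) // !big_seq1 divn1 !ln1 !mulr0 oppr0.
have := sum_moebius n0; rewrite gtn_eqF // => S0.
apply/eqP; rewrite -subr_eq0 -sumrB; apply/eqP.
transitivity (\sum_(d <- divisors n) moebius d * ln n%:R); last by rewrite -mulr_suml S0 mul0r.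
apply: eq_big_seq => d; rewrite -dvdn_divisors // => dn.
have d0 := dvdn_gt0 n0 dn.
have nd0 : (0 < n %/ d)%N by rewrite divn_gt0 // dvdn_leq.
have -> : ln n%:R = ln (n %/ d)%:R + ln d%:R :> R.
  by rewrite -{1}(divnK dn) natrM lnM ?posrE ?ltr0n.
ring.
Qed.

End ArithmeticFunctions.

(** * The estimates of Chebyshev and Mertens *)

Lemma sum_widen (M : nmodType) (m n : nat) (F : nat -> M) : (m <= n)%N ->
  \sum_(1 <= k < m.+1) F k = \sum_(1 <= k < n.+1) (if (k <= m)%N then F k else 0).
Proof. by move=> mn; rewrite -big_mkcond (@big_nat_widen _ _ _ _ m.+1 n.+1). Qed.

Lemma sum_hyperbola_sym (M : nmodType) (N : nat) (f : nat -> nat -> M) :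
  \sum_(1 <= d < N.+1) \sum_(1 <= m < (N %/ d).+1) f d m =
  \sum_(1 <= m < N.+1) \sum_(1 <= d < (N %/ m).+1) f d m.
Proof.
have E (g : nat -> nat -> M) : \sum_(1 <= d < N.+1) \sum_(1 <= m < (N %/ d).+1) g d m =
    \sum_(1 <= d < N.+1) \sum_(1 <= m < N.+1) (if (d * m <= N)%N then g d m else 0).
  apply: eq_big_nat => d /andP[d0 _]; rewrite (sum_widen _ (leq_div N d)).
  by apply: eq_bigr => m _; rewrite leq_divRL // mulnC.
rewrite E (E (fun m d => f d m)) exchange_big /=.
by apply: eq_bigr => m _; apply: eq_bigr => d _; rewrite mulnC.
Qed.

Section ChebyshevMertens.
Variable R : realType.
Local Notation Lam := (@vonMangoldt R).
Implicit Types (n m d N : nat) (a b x y : R).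

Lemma ln_sub_le a b : 0 < a -> 0 < b -> ln b - ln a <= (b - a) / a.
Proof.
move=> a0 b0; rewrite -ln_div ?posrE //.
have -> : b / a = 1 + (b - a) / a by field; rewrite gt_eqF.
apply: le_ln1Dx; rewrite -(ltrD2l 1) subrr.
have -> : 1 + (b - a) / a = b / a by field; rewrite gt_eqF.
exact: divr_gt0.
Qed.

Lemma ln_sub_ge a b : 0 < a -> 0 < b -> (b - a) / b <= ln b - ln a.
Proof.
by move=> a0 b0; have := ln_sub_le b0 a0; rewrite -[a - b]opprB mulNr; lra.
Qed.

Lemma lnS_le n : (0 < n)%N -> ln n.+1%:R - ln n%:R <= n%:R^-1 :> R.
Proof.
move=> n0; have := @ln_sub_le n%:R n.+1%:R; rewrite !ltr0n n0 => /(_ isT isT).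
by rewrite -natr1 addrAC subrr add0r mul1r.
Qed.

Lemma lnS_ge n : (0 < n)%N -> n.+1%:R^-1 <= ln n.+1%:R - ln n%:R :> R.
Proof.
move=> n0; have := @ln_sub_ge n%:R n.+1%:R; rewrite !ltr0n n0 => /(_ isT isT).
by rewrite -{1}natr1 addrAC subrr add0r mul1r.
Qed.

Lemma ln_nat_ge0 n : 0 <= ln n%:R :> R.
Proof. by case: n => [|n]; [rewrite ln0|rewrite ln_ge0 // ler1n]. Qed.

Lemma ln_nat_le n : ln n%:R <= n%:R :> R.
Proof. by case: n => [|n]; [rewrite ln0|rewrite ltW // ln_sublinear // ltr0n]. Qed.

Lemma ler_ln_nat n m : (0 < n <= m)%N -> ln n%:R <= ln m%:R :> R.
Proof.
by case/andP=> n0 nm; rewrite ler_ln ?posrE ?ltr0n ?ler_nat // (leq_trans n0).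
Qed.

Definition ln_fact N : R := \sum_(1 <= n < N.+1) ln n%:R.

Definition psi N : R := \sum_(1 <= n < N.+1) Lam n.

Definition harmonic_sum N : R := \sum_(1 <= n < N.+1) n%:R^-1.

(** The sum of Mertens' first theorem, not the summatory function of mu. *)
Definition mertens N : R := \sum_(1 <= n < N.+1) Lam n / n%:R.

Lemma stirling N : (0 < N)%N ->
  N%:R * ln N%:R - N%:R + 1 <= ln_fact N <= N%:R * ln N%:R - N%:R + 1 + ln N%:R.
Proof.
case: N => // N _; elim: N => [|N /andP[IH1 IH2]].
  by rewrite /ln_fact big_nat1 ln1; lra.
rewrite {1 2}/ln_fact big_nat_recr //= -/(ln_fact N.+1).
have := @lnS_le N.+1 isT; have := @lnS_ge N.+1 isT.
set l := ln _ => h1 h2; move: h1 h2 IH1 IH2; set l' := ln _ => h1 h2 IH1 IH2.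
have N0 : 0 < N.+1%:R :> R by rewrite ltr0n.
have e : N.+2%:R = N.+1%:R + 1 :> R by rewrite natr1.
have e0 : 0 < N.+2%:R :> R by rewrite ltr0n.
have k1 : 1 <= (l - l') * N.+2%:R by rewrite -ler_pdivrMr // div1r.
have k2 : (l - l') * N.+1%:R <= 1 by rewrite -ler_pdivlMr // div1r.
by rewrite e in k1 *; apply/andP; split; nra.
Qed.

(** H_n - ln(n+1) increases, H_n - ln n decreases, and they differ by at most 1/n; c is the supremum
    of the former. *)
Lemma euler_mascheroni : exists c : R, forall n, (0 < n)%N ->
  0 <= harmonic_sum n - ln n%:R - c <= n%:R^-1.
Proof.
pose u n : R := harmonic_sum n - ln n.+1%:R.
pose v n : R := harmonic_sum n - ln n%:R.
have hS n : harmonic_sum n.+1 = harmonic_sum n + n.+1%:R^-1.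
  by rewrite /harmonic_sum big_nat_recr.
have uS n : (0 < n)%N -> u n <= u n.+1.
  move=> n0; rewrite /u hS; have := @lnS_le n.+1 isT; set i := _^-1; lra.
have vS n : (0 < n)%N -> v n.+1 <= v n.
  move=> n0; rewrite /v hS; have := lnS_ge n0; set i := _^-1; lra.
have uv n : (0 < n)%N -> u n <= v n.
  move=> n0; rewrite /u /v lerD2l lerN2 ler_ln_nat // n0 leqnSn //.
have mu n m : (0 < n <= m)%N -> u n <= u m.
  case/andP=> n0; elim: m => [|m IH]; first lia.
  rewrite leq_eqVlt => /orP[/eqP ->//|nm]; apply: le_trans (IH _) (uS _ _) => //; lia.
have mv n m : (0 < n <= m)%N -> v m <= v n.
  case/andP=> n0; elim: m => [|m IH]; first lia.
  rewrite leq_eqVlt => /orP[/eqP ->//|nm]; apply: le_trans (vS _ _) (IH _) => //; lia.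
pose E := [set u n | n in [set n | 0 < n]%N]%classic.
have ubE n : (0 < n)%N -> ubound E (v n).
  move=> n0 _ [m m0 <-].
  apply: (@le_trans _ _ (u (maxn n m))).
    by apply: mu; rewrite m0 leq_maxr.
  apply: le_trans (uv _ _) (mv _ _ _); first by rewrite leq_max n0.
  by rewrite n0 leq_maxl.
have supE : has_sup E by split; [exists (u 1%N); exists 1%N|exists (v 1%N); exact: ubE].
exists (sup E) => n n0; apply/andP; split.
  have : sup E <= v n by apply: ge_sup; [case: supE|exact: ubE].
  by rewrite /v; lra.
have : u n <= sup E by apply: ub_le_sup; [case: supE|exists n].
by rewrite /u; have := lnS_le n0; set i := _^-1; lra.
Qed.

Lemma ln_fact_vonMangoldt N : ln_fact N = \sum_(1 <= d < N.+1) Lam d * (N %/ d)%:R.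
Proof.
rewrite /ln_fact (eq_big_nat _ _ (F2 := fun k => \sum_(d <- divisors k) Lam d)); last first.
  by move=> k /andP[k0 _]; rewrite sum_vonMangoldt.
rewrite sum_divisors_exchange; apply: eq_bigr => d _.
by rewrite sumr_const_nat subn1 /= mulr_natr.
Qed.

Lemma ln_fact_psi N : ln_fact N = \sum_(1 <= m < N.+1) psi (N %/ m).
Proof.
rewrite ln_fact_vonMangoldt -(sum_hyperbola_sym N (fun d m => Lam d)).
by apply: eq_bigr => d _; rewrite sumr_const_nat subn1 /= mulr_natr.
Qed.

Lemma psi_ge0 N : 0 <= psi N.
Proof. by apply: sumr_ge0 => d _; exact: vonMangoldt_ge0. Qed.

(** Lambda(d) occurs on the right with coefficient floor(N/d) - 2 floor(floor(N/2)/d). This is never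
    negative, and it is at least 1 when floor(N/2) < d <= N. *)
Lemma psi_half N : psi N - psi (N %/ 2) <= ln_fact N - 2 * ln_fact (N %/ 2).
Proof.
rewrite !ln_fact_vonMangoldt /psi !(sum_widen _ (leq_div N 2)) mulr_sumr -!sumrB.
apply: ler_sum_nat => d /andP[d0 dN].
have L0 := vonMangoldt_ge0 R d.
have k : (2 * (N %/ 2 %/ d) <= N %/ d)%N.
  by rewrite leq_divRL // -mulnA (leq_trans _ (leq_trunc_div N 2)) // mulnC leq_mul // leq_trunc_div.
case: leqP => h.
  rewrite subrr mulrCA -mulrBr mulr_ge0 // subr_ge0 -natrM ler_nat //.
have k1 : (1 <= N %/ d)%N by rewrite leq_divRL // mul1n.
by rewrite mulr0 !subr0 -{1}[Lam d]mulr1 ler_wpM2l // ler1n.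
Qed.

Lemma psi_le N : psi N <= 8 * N%:R.
Proof.
elim/ltn_ind: N => N IH; have [N1|N1] := ltnP N 2.
  case: N N1 {IH} => [|[|//]] _; rewrite /psi; first by rewrite big_geq //; lra.
  by rewrite big_nat1 vonMangoldt1; lra.
set M := (N %/ 2)%N; have M0 : (0 < M)%N by rewrite divn_gt0.
have N0 : (0 < N)%N by lia.
have := IH M (@ltn_Pdiv N 2 isT N0); have := psi_half N; rewrite -/M.
have /andP[_ h1] := stirling N0; have /andP[h2 _] := stirling M0.
have := ln_nat_le N; have := ln_nat_ge0 N; have := ln_nat_ge0 M.
have Mr : 0 < M%:R :> R by rewrite ltr0n.
have Nr : 0 < N%:R :> R by rewrite ltr0n.
have : ln N%:R - ln M%:R <= 2 :> R.
  apply: le_trans (ln_sub_le Mr Nr) _; rewrite ler_pdivrMr //.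
  have : N%:R <= (3 * M)%:R :> R by rewrite ler_nat /M; lia.
  by rewrite natrM; lra.
have e : exists2 r : R, 0 <= r <= 1 & N%:R = 2 * M%:R + r.
  exists (N %% 2)%:R; last by rewrite -natrM -natrD mulnC -divn_eq.
  by rewrite ler0n lern1 -ltnS ltn_mod.
move: e h1 h2 => [r /andP[r0 r1] ->]; set lN := ln _; set lM := ln _ => h1 h2 d a b c d' e.
nra.
Qed.

(** N times the Mertens sum exceeds ln N! by the sum of Lambda(d) times the fractional part of N/d,
    which lies between 0 and [psi N] <= 8 N. Then [stirling] applies. *)
Lemma mertens_bounds N : (0 < N)%N -> -1 <= mertens N - ln N%:R <= 9.
Proof.
move=> N0; have Nr : 0 < N%:R :> R by rewrite ltr0n.
have N1 : 1 <= N%:R :> R by rewrite ler1n.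
have /andP[s1 s2] := stirling N0.
have h1 : ln_fact N <= N%:R * mertens N.
  rewrite ln_fact_vonMangoldt /mertens mulr_sumr; apply: ler_sum_nat => d /andP[d0 _].
  rewrite mulrCA ler_wpM2l ?vonMangoldt_ge0 // ler_pdivlMr ?ltr0n //.
  by rewrite -natrM ler_nat leq_trunc_div.
have h2 : N%:R * mertens N <= ln_fact N + psi N.
  rewrite ln_fact_vonMangoldt /mertens mulr_sumr -big_split; apply: ler_sum_nat => d /andP[d0 _].
  rewrite /= -[X in _ + X]mulr1 -mulrDr mulrCA ler_wpM2l ?vonMangoldt_ge0 //.
  rewrite ler_pdivrMr ?ltr0n // natr1 -natrM ler_nat ltnW // ltn_ceil //.
have := psi_le N; have := ln_nat_le N => l p.
apply/andP; split; rewrite -(ler_pM2l Nr); nra.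
Qed.

End ChebyshevMertens.

(** * Selberg's formula *)

Section Selberg.
Variable R : realType.
Local Notation Lam := (@vonMangoldt R).
Local Notation psi := (@psi R).
Local Notation ln_fact := (@ln_fact R).
Local Notation mertens := (@mertens R).
Implicit Types (n m d k N X Y : nat) (a b c x y K : R).

(** With s = y^(1/4), 1 + ln y = 1 + 4 ln s <= 4 s - 3 <= 4 s. *)
Lemma sqr_ln1D_le y : 1 <= y -> (1 + ln y) ^+ 2 <= 16 * Num.sqrt y.
Proof.
move=> y1; have y0 : 0 <= y by lra.
set r := Num.sqrt y; set s := Num.sqrt r.
have rE : r ^+ 2 = y by rewrite sqr_sqrtr.
have r1 : 1 <= r by rewrite -sqrtr1 ler_wsqrtr.
have sE : s ^+ 2 = r by rewrite sqr_sqrtr //; lra.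
have s1 : 1 <= s by rewrite -sqrtr1 ler_wsqrtr.
have lE : ln y = 4 * ln s.
  by rewrite -rE -sE -exprM lnXn ?mulr_natl //; lra.
have ls : ln s <= s - 1.
  by have := @ln_sub_le R 1 s ltr01 ltac:(lra); rewrite ln1 subr0 divr1.
have := ln_ge0 s1; rewrite lE -sE; nra.
Qed.

Lemma sum_inv_sqrt_le N :
  \sum_(1 <= d < N.+1) (Num.sqrt d%:R)^-1 <= 2 * Num.sqrt N%:R :> R.
Proof.
elim: N => [|N IH]; first by rewrite big_geq // sqrtr0 mulr0.
rewrite big_nat_recr //=; apply: le_trans (lerD IH (lexx _)) _.
have : Num.sqrt N%:R ^+ 2 = N%:R :> R by rewrite sqr_sqrtr.
have : Num.sqrt N.+1%:R ^+ 2 = N.+1%:R :> R by rewrite sqr_sqrtr.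
have : 0 < Num.sqrt N.+1%:R :> R by rewrite sqrtr_gt0 ltr0n.
have : 0 <= Num.sqrt N%:R :> R by rewrite sqrtr_ge0.
rewrite -natr1; set a := Num.sqrt _; set b := Num.sqrt _ => a0 b0 b2 a2.
have -> : 2 * b = 2 * a + (2 * b - 2 * a) by ring.
by rewrite lerD2l -(ler_pM2r b0) mulVf ?gt_eqF //; nra.
Qed.

(** Bounding each term by 16 sqrt(N/d) leaves no logarithm in the total, as the O(N) error of
    Selberg's formula requires. *)
Lemma sum_sqr_ln_le N :
  \sum_(1 <= d < N.+1) (1 + ln (N%:R / d%:R)) ^+ 2 <= 32 * N%:R :> R.
Proof.
apply: (@le_trans _ _ (\sum_(1 <= d < N.+1) 16 * Num.sqrt N%:R * (Num.sqrt d%:R)^-1)).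
  apply: ler_sum_nat => d /andP[d0 dN].
  have dr : 0 < d%:R :> R by rewrite ltr0n.
  apply: le_trans (sqr_ln1D_le _) _; first by rewrite ler_pdivlMr // mul1r ler_nat.
  by rewrite sqrtrM ?ler0n // sqrtrV ?ler0n // mulrA.
rewrite -mulr_sumr; have := sum_inv_sqrt_le N.
have : Num.sqrt N%:R ^+ 2 = N%:R :> R by rewrite sqr_sqrtr.
have := sqrtr_ge0 (N%:R : R).
set a := Num.sqrt _; set b := \sum_(_ <= _ < _) _ => a0 a2 h; nra.
Qed.

(* The weights of Tatuzawa and Iseki: their divisor sums cancel to O(log). *)
Definition selberg_weight c N k : R := psi (N %/ k) - N%:R / k%:R + (c + 1).

Lemma sum_selberg_weight c N d : (0 < d)%N ->
  \sum_(1 <= m < (N %/ d).+1) selberg_weight c N (d * m) =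
  ln_fact (N %/ d) - N%:R / d%:R * harmonic_sum R (N %/ d) + (c + 1) * (N %/ d)%:R.
Proof.
move=> d0; rewrite /selberg_weight big_split sumrB /=; congr (_ - _ + _).
- by rewrite ln_fact_psi; apply: eq_bigr => m _; rewrite divnMA.
- rewrite /harmonic_sum mulr_sumr; apply: eq_bigr => m _.
  by rewrite natrM invfM mulrA.
- by rewrite sumr_const_nat subn1 /= mulr_natr.
Qed.

(** Put M = floor(N/d), y = N/d and t = y - M. Up to O(1 + ln M), the first two terms in
    [sum_selberg_weight] are M ln M - M and y (ln M + c); together with (c + 1) M they leave only -t
    (ln M + c), where 0 <= t <= 1. *)
Lemma sum_selberg_weight_le c N d :
  (forall n, (0 < n)%N -> 0 <= harmonic_sum R n - ln n%:R - c <= n%:R^-1) ->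
  (0 < d <= N)%N ->
  `|\sum_(1 <= m < (N %/ d).+1) selberg_weight c N (d * m)|
    <= (3 + `|c|) * (1 + ln (N%:R / d%:R)).
Proof.
move=> hc /andP[d0 dN]; rewrite sum_selberg_weight //.
have dr : 0 < d%:R :> R by rewrite ltr0n.
set M := (N %/ d)%N; set y := N%:R / d%:R.
have M0 : (0 < M)%N by rewrite divn_gt0.
have Mr : 1 <= M%:R :> R by rewrite ler1n.
have My : M%:R <= y by rewrite ler_pdivlMr // -natrM ler_nat leq_trunc_div.
have yM : y <= M%:R + 1 by rewrite ler_pdivrMr // natr1 -natrM ler_nat ltnW // ltn_ceil.
have /andP[s1 s2] := stirling R M0.
have /andP := hc M M0; set H := harmonic_sum R M; move=> [h1 h2].
have h3 : (H - ln M%:R - c) * M%:R <= 1 by rewrite -ler_pdivlMr ?div1r //; lra.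
have lM := ln_nat_ge0 R M.
have ly : ln M%:R <= ln y by rewrite ler_ln ?posrE //; lra.
move: (ln_fact M) s1 s2 => f s1 s2; move: (ln y) (ln M%:R) ly lM h1 h2 h3 s1 s2 => L l ly.
move=> lM h1 h2 h3 s1 s2.
have [e eE] : exists e, e = H - l - c by eexists.
have HE : H = l + c + e by rewrite eE; ring.
rewrite -eE in h1 h3; rewrite HE.
have ye : 0 <= y * e <= 2 by apply/andP; split; nra.
have -> : f - y * (l + c + e) + (c + 1) * M%:R =
  (f - (M%:R * l - M%:R + 1)) + 1 - y * e - (y - M%:R) * l - (y - M%:R) * c by ring.
set t := y - M%:R; have t0 : 0 <= t <= 1 by rewrite /t; lra.
have tl : 0 <= t * l <= l by apply/andP; split; nra.
have tc : `|t * c| <= `|c|.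
  by rewrite normrM ger0_norm ?ler_piMl //; lra.
have c0 : 0 <= `|c| by [].
apply: le_trans (ler_normB _ _) _.
have : `|f - (M%:R * l - M%:R + 1) + 1 - y * e - t * l| <= 3 + 3 * l.
  by rewrite ler_norml; apply/andP; split; lra.
have cL : 0 <= `|c| * L by rewrite mulr_ge0 //; lra.
by move=> hA; apply: (le_trans (lerD hA tc)); lra.
Qed.

(** Collecting the left side by k = d m, the weight at k has as coefficient the sum over d | k of
    mu(d) (ln N - ln d). This is Lambda(k), plus ln N if k = 1. *)
Lemma tatuzawa_iseki c N : (0 < N)%N ->
  \sum_(1 <= d < N.+1) moebius R d * (ln N%:R - ln d%:R) *
     (\sum_(1 <= m < (N %/ d).+1) selberg_weight c N (d * m)) =
  selberg_weight c N 1 * ln N%:R + \sum_(1 <= k < N.+1) Lam k * selberg_weight c N k.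
Proof.
move=> N0; transitivity (\sum_(1 <= k < N.+1) \sum_(d <- divisors k)
    moebius R d * (ln N%:R - ln d%:R) * selberg_weight c N k).
  by rewrite sum_divisors_exchange; apply: eq_bigr => d _; rewrite mulr_sumr.
rewrite (eq_big_nat _ _ (F2 := fun k => (k == 1%N)%:R * ln N%:R * selberg_weight c N k
   + Lam k * selberg_weight c N k)); last first.
  move=> k /andP[k0 _]; rewrite -mulr_suml -mulrDl; congr (_ * _).
  rewrite -(sum_moebius R k0) -[Lam k]opprK -(sum_moebius_ln R k0) mulr_suml -sumrB.
  by apply: eq_bigr => d _; rewrite mulrBr.
rewrite big_split /=; congr (_ + _).
rewrite big_ltn // eqxx mul1r big_nat big1 ?addr0 1?mulrC // => k /andP[k1 _].
by rewrite gtn_eqF // !mul0r.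
Qed.

Lemma selberg_psi : exists K, forall N, (0 < N)%N ->
  `|psi N * ln N%:R + \sum_(1 <= k < N.+1) Lam k * psi (N %/ k) - 2 * N%:R * ln N%:R|
    <= K * N%:R.
Proof.
have [c hc] := euler_mascheroni R.
(* The first term bounds the left side of [tatuzawa_iseki]; the second covers (c + 1) ([psi N] + ln
   N), with [psi N] <= 8 N and ln N <= N; the third covers N ([mertens N] - ln N). *)
exists ((3 + `|c|) * 32 + 9 * `|c + 1| + 9) => N N0.
have Nr : 1 <= N%:R :> R by rewrite ler1n.
have TI := tatuzawa_iseki c N0.
have B : `|\sum_(1 <= d < N.+1) moebius R d * (ln N%:R - ln d%:R) *
     (\sum_(1 <= m < (N %/ d).+1) selberg_weight c N (d * m))| <= (3 + `|c|) * 32 * N%:R.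
  apply: le_trans (ler_norm_sum _ _ _) _.
  apply: (@le_trans _ _ (\sum_(1 <= d < N.+1) (3 + `|c|) * (1 + ln (N%:R / d%:R)) ^+ 2)).
    apply: ler_sum_nat => d /andP[d0 dN].
    have dr : 0 < d%:R :> R by rewrite ltr0n.
    have := @sum_selberg_weight_le c N d hc; rewrite d0 -ltnS => /(_ dN).
    have L0 : 0 <= ln (N%:R / d%:R) :> R.
      by rewrite ln_ge0 // ler_pdivlMr // mul1r ler_nat.
    rewrite -ln_div ?posrE ?ltr0n // !normrM => h.
    apply: (@le_trans _ _ (1 * ln (N%:R / d%:R) * ((3 + `|c|) * (1 + ln (N%:R / d%:R))))).
      apply: ler_pM => //; first by rewrite mulr_ge0.
      by rewrite (ger0_norm L0) ler_wpM2r ?normr_moebius_le1.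
    have c0 : 0 <= `|c| by [].
    rewrite mul1r mulrCA expr2 mulrA [X in _ <= X]mulrA mulrAC -!mulrA.
    by rewrite ler_wpM2l ?addr_ge0 //; nra.
  by rewrite -mulr_sumr -mulrA ler_wpM2l ?addr_ge0 // sum_sqr_ln_le.
rewrite {}TI in B.
have E : \sum_(1 <= k < N.+1) Lam k * selberg_weight c N k =
    \sum_(1 <= k < N.+1) Lam k * psi (N %/ k) - N%:R * mertens N + (c + 1) * psi N.
  rewrite /mertens -[psi N]/(\sum_(1 <= n < N.+1) Lam n) !mulr_sumr -sumrB -big_split; apply: eq_bigr => k _ /=.
  by rewrite /selberg_weight; ring.
move: B; rewrite {}E /selberg_weight !divn1 divr1.
set S := \sum_(_ <= _ < _) _ => B.
have [p0 p8] := (psi_ge0 R N, psi_le R N).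
have [l0 lN] := (ln_nat_ge0 R N, ln_nat_le R N).
have /andP[m1 m2] := mertens_bounds R N0.
move: (psi N) (ln N%:R) (mertens N) p0 p8 l0 lN m1 m2 B => p l m p0 p8 l0 lN m1 m2 B.
have -> : p * l + S - 2 * N%:R * l = ((p - N%:R + (c + 1)) * l + (S - N%:R * m + (c + 1) * p))
   + N%:R * (m - l) - (c + 1) * (p + l) by ring.
have h1 : `|N%:R * (m - l)| <= 9 * N%:R.
  by rewrite normrM ger0_norm ?ler0n // mulrC ler_wpM2r // ler_norml; lra.
have h2 : `|(c + 1) * (p + l)| <= 9 * `|c + 1| * N%:R.
  rewrite normrM -mulrA mulrCA ler_wpM2l // ger0_norm; lra.
apply: le_trans (ler_normB _ _) _; apply: le_trans (lerD (ler_normD _ _) h2) _.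
by nra.
Qed.

(** Partial summation by induction: passing from N to N + 1 adds psi(N) (ln(N+1) - ln N), which lies
    between 0 and 8 by [psi_le]. *)
Lemma sum_vonMangoldt_ln_bounds N : (0 < N)%N ->
  0 <= psi N * ln N%:R - \sum_(1 <= k < N.+1) Lam k * ln k%:R <= 8 * N%:R.
Proof.
case: N => // N _; elim: N => [|N /andP[IH1 IH2]].
  by rewrite /psi !big_nat1 ln1; lra.
have psiS : psi N.+2 = psi N.+1 + Lam N.+2 by rewrite /psi big_nat_recr.
rewrite big_nat_recr //= psiS.
have := psi_ge0 R N.+1; have := psi_le R N.+1.
have := @lnS_le R N.+1 isT; have := @ler_ln_nat R N.+1 N.+2 ltac:(lia).
have N1 : 0 < N.+1%:R :> R by rewrite ltr0n.
have i : N.+1%:R * N.+1%:R^-1 = 1 :> R by rewrite mulfV // gt_eqF.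
have -> : N.+2%:R = N.+1%:R + 1 :> R by rewrite natr1.
move: IH1 IH2; set S := \sum_(_ <= _ < _) _.
move: N1 i.
move: (psi N.+1) (Lam N.+2) (N.+1%:R) (N.+1%:R^-1) (ln N.+1%:R) (ln (N.+1%:R + 1)) .
move=> p L n j l l' n0 nj IH1 IH2 a b p1 p2.
have h : 0 <= p * (l' - l) <= 8.
  apply/andP; split; first by rewrite mulr_ge0 //; lra.
  apply: (@le_trans _ _ (8 * n * j)); last by rewrite -mulrA nj; lra.
  by apply: ler_pM => //; lra.
by apply/andP; split; lra.
Qed.

(** Selberg's function Lambda_2; the second term is the Dirichlet convolution of Lambda with
    itself. *)
Definition selberg n : R := Lam n * ln n%:R + \sum_(d <- divisors n) Lam d * Lam (n %/ d).

Lemma selberg_formula : exists K, forall N, (0 < N)%N ->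
  `|\sum_(1 <= k < N.+1) selberg k - 2 * N%:R * ln N%:R| <= K * N%:R.
Proof.
have [K hK] := selberg_psi; exists (K + 8) => N N0.
have := hK N N0; have /andP[] := sum_vonMangoldt_ln_bounds N0.
rewrite /selberg big_split /=.
have -> : \sum_(1 <= k < N.+1) \sum_(d <- divisors k) Lam d * Lam (k %/ d) =
   \sum_(1 <= k < N.+1) Lam k * psi (N %/ k).
  rewrite (sum_divisors_exchange N (fun d k => Lam d * Lam (k %/ d))).
  apply: eq_big_nat => d /andP[d0 _].
  by rewrite /psi mulr_sumr; apply: eq_bigr => m _; rewrite mulKn.
set S := \sum_(_ <= _ < _) _ * ln _; set T := \sum_(_ <= _ < _) _ * _ (_ %/ _)%N.
rewrite !ler_norml => a b /andP[c d]; apply/andP; split; lra.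
Qed.

(** Abel summation: with C(N) the partial sums of u(k) and S(N) those of u(k)/k, the quantity S(N) -
    C(N)/(N+1) moves by at most K (ln(N+1) - ln N) from N to N + 1. The two boundary terms cost 2
    K. *)
Lemma sum_abel_bounds (u : nat -> R) K X Y : 0 <= K ->
  (forall N, (0 < N)%N -> `|\sum_(1 <= k < N.+1) u k| <= K * N%:R) ->
  (0 < X <= Y)%N ->
  `|\sum_(1 <= k < Y.+1) u k / k%:R - \sum_(1 <= k < X.+1) u k / k%:R|
    <= K * (2 + (ln Y%:R - ln X%:R)).
Proof.
move=> K0 hu /andP[X0 XY].
pose C N := \sum_(1 <= k < N.+1) u k; pose S N := \sum_(1 <= k < N.+1) u k / k%:R.
pose E N := S N - C N / N.+1%:R.
have CK N : (0 < N)%N -> `|C N / N.+1%:R| <= K.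
  move=> N0; rewrite normrM normfV normr_nat ler_pdivrMr ?ltr0n //.
  by apply: le_trans (hu N N0) _; rewrite ler_wpM2l // ler_nat.
have step N : (0 < N)%N -> `|E N.+1 - E N| <= K * (ln N.+1%:R - ln N%:R).
  move=> N0; have n1 : N.+1%:R != 0 :> R by rewrite pnatr_eq0.
  have n2 : N.+2%:R != 0 :> R by rewrite pnatr_eq0.
  have -> : E N.+1 - E N = C N.+1 / N.+2%:R / N.+1%:R.
    have e : N.+2%:R = N.+1%:R + 1 :> R by rewrite natr1.
    have SS : S N.+1 = S N + u N.+1 / N.+1%:R by rewrite /S big_nat_recr.
    have CS : C N.+1 = C N + u N.+1 by rewrite /C big_nat_recr.
    rewrite /E SS CS e; rewrite e in n2; move: (N.+1%:R : R) n1 n2 => t n1 n2.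
    by field; rewrite n1 n2.
  rewrite normrM normfV normr_nat.
  apply: ler_pM; rewrite ?invr_ge0 ?ler0n ?CK //; exact: lnS_ge.
have EY : `|E Y - E X| <= K * (ln Y%:R - ln X%:R).
  elim: Y XY => [|Y IH] XY; first by lia.
  move: XY; rewrite leq_eqVlt => /orP[/eqP <-|XY]; first by rewrite !subrr mulr0 normr0.
  have -> : E Y.+1 - E X = (E Y.+1 - E Y) + (E Y - E X) by ring.
  apply: le_trans (ler_normD _ _) _.
  have := step Y ltac:(lia); have := IH XY; lra.
have := CK X X0; have := CK Y (leq_trans X0 XY).
rewrite -/(S Y) -/(S X); have -> : S Y - S X = (E Y - E X) + C Y / Y.+1%:R - C X / X.+1%:R.
  by rewrite /E; ring.
move=> a b; apply: le_trans (ler_normB _ _) _; apply: le_trans (lerD (ler_normD _ _) (lexx _)) _.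
lra.
Qed.

(** A model for [selberg]: the partial sums agree up to O(N), while the terms divided by n telescope
    to ln^2 N. As [ln 0] is 0, the term at n = 1 vanishes. *)
Lemma sum_sqr_ln_diff N : (0 < N)%N ->
  `|\sum_(1 <= n < N.+1) n%:R * (ln n%:R ^+ 2 - ln n.-1%:R ^+ 2) - 2 * N%:R * ln N%:R|
    <= 4 * N%:R :> R.
Proof.
case: N => // N _; elim: N => [|N IH].
  by rewrite big_nat1 /= ln1 ln0 // !(mulr0, expr0n, subrr) normr0; lra.
rewrite big_nat_recr //=.
have N2 : 0 < N.+2%:R :> R by rewrite ltr0n.
have N1 : 1 <= N.+1%:R :> R by rewrite ler1n.
have N0 : 0 < N.+1%:R :> R by rewrite ltr0n.
have : (ln N.+2%:R - ln N.+1%:R) * N.+1%:R <= 1 :> R by rewrite -ler_pdivlMr // div1r lnS_le.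
have : 1 <= (ln N.+2%:R - ln N.+1%:R) * N.+2%:R :> R by rewrite -ler_pdivrMr // div1r lnS_ge.
have := @le_ln1Dx _ (N.+1%:R : R); rewrite [1 + _]addrC natr1 => /(_ ltac:(lra)).
have := ln_nat_ge0 R N.+2.
move: IH; set S := \sum_(_ <= _ < _) _.
have -> : N.+2%:R = N.+1%:R + 1 :> R by rewrite natr1.
move: N1 {N0 N2}; move: (N.+1%:R : R) (ln N.+1%:R) (ln (N.+1%:R + 1)) => m l' l m1.
rewrite !ler_norml => /andP[a b] l0 lm c d.
have [e eE] : exists e, e = l - l' by eexists.
have lE : l' = l - e by rewrite eE; ring.
rewrite {}lE in a b c d *; have e0 : 0 <= e by nra.
have e1 : e <= 1 by nra.
have k1 : 0 <= l * ((m + 1) * e - 1) by rewrite mulr_ge0 //; nra.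
have k2 : l * ((m + 1) * e - 1) <= 1.
  apply: (@le_trans _ _ (m * e)); last by nra.
  by apply: ler_pM => //; nra.
apply/andP; split; nra.
Qed.

Definition selberg_mean N : R := \sum_(1 <= k < N.+1) selberg k / k%:R.

(** [selberg] minus the model sequence of [sum_sqr_ln_diff] has partial sums O(N), so
    [sum_abel_bounds] applies; the model contributes exactly ln^2 Y - ln^2 X. *)
Lemma selberg_mean_bounds : exists2 K, 0 <= K & forall X Y, (0 < X <= Y)%N ->
  `|selberg_mean Y - selberg_mean X - (ln Y%:R ^+ 2 - ln X%:R ^+ 2)|
    <= K * (2 + (ln Y%:R - ln X%:R)).
Proof.
have [K hK] := selberg_formula.
have K0 : 0 <= K by have := le_trans (normr_ge0 _) (hK 1%N isT); rewrite mulr1.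
exists (K + 4) => [|X Y XY]; first lra.
pose u n : R := selberg n - n%:R * (ln n%:R ^+ 2 - ln n.-1%:R ^+ 2).
have hu N : (0 < N)%N -> `|\sum_(1 <= k < N.+1) u k| <= (K + 4) * N%:R.
  move=> N0; rewrite /u sumrB.
  have := hK N N0; have := sum_sqr_ln_diff N0; set A := \sum_(_ <= _ < _) _; set B := \sum_(_ <= _ < _) _.
  by rewrite !ler_norml => /andP[? ?] /andP[? ?]; apply/andP; split; lra.
have := @sum_abel_bounds u (K + 4) X Y ltac:(lra) hu XY.
have E N : \sum_(1 <= k < N.+1) u k / k%:R = selberg_mean N - ln N%:R ^+ 2.
  rewrite /selberg_mean; elim: N => [|N IH].
    by rewrite !big_geq // ln0 // expr0n subrr.
  rewrite big_nat_recr //= IH [in RHS]big_nat_recr //= /u.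
  have n1 : N.+1%:R != 0 :> R by rewrite pnatr_eq0.
  by move: (N.+1%:R : R) n1 => t t0; field.
by rewrite !E; congr (`|_| <= _); ring.
Qed.

Lemma selberg_meanE N : selberg_mean N =
  \sum_(1 <= n < N.+1) Lam n * ln n%:R / n%:R +
  \sum_(1 <= d < N.+1) Lam d / d%:R * mertens (N %/ d).
Proof.
rewrite /selberg_mean /selberg (eq_bigr _ (fun k _ => mulrDl _ _ _)) big_split /=.
congr (_ + _); under eq_bigr => k _ do rewrite mulr_suml.
rewrite (sum_divisors_exchange N (fun d k => Lam d * Lam (k %/ d) / k%:R)).
apply: eq_big_nat => d /andP[d0 _]; rewrite /mertens mulr_sumr.
by apply: eq_bigr => m _; rewrite mulKn // natrM invfM; ring.
Qed.

End Selberg.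

(** * The logarithmic mass of prime powers *)

Section Erdos.
Variable R : realType.
Local Notation Lam := (@vonMangoldt R).
Local Notation mertens := (@mertens R).
Local Notation truncn := Num.truncn.
Implicit Types (n m d k N X Y : nat) (a b c x y t h e : R) (f : nat -> R).

Definition weighted_sum f t : R :=
  \sum_(1 <= n < (truncn t).+1) Lam n / n%:R * f n.

Definition log_mass : R -> R := weighted_sum (fun=> 1).

Lemma log_massE t : log_mass t = mertens (truncn t).
Proof. by apply: eq_bigr => n _; rewrite mulr1. Qed.

Lemma weighted_sum_sub f a b : a <= b -> weighted_sum f b - weighted_sum f a =
  \sum_((truncn a).+1 <= n < (truncn b).+1) Lam n / n%:R * f n.
Proof.
move=> ab; rewrite /weighted_sum (big_cat_nat (n := (truncn a).+1)) ?ltnS ?le_truncn //=.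
by rewrite addrAC subrr add0r.
Qed.

Lemma vonMangoldt_div_ge0 n : 0 <= Lam n / n%:R.
Proof. by rewrite divr_ge0 ?vonMangoldt_ge0 // ler0n. Qed.

Lemma weighted_sum_diff_le f g a b : a <= b -> 0 <= b ->
  (forall n, a < n%:R <= b -> f n <= g n) ->
  weighted_sum f b - weighted_sum f a <= weighted_sum g b - weighted_sum g a.
Proof.
move=> ab b0 fg; rewrite !weighted_sum_sub //; apply: ler_sum_nat => n /andP[an nb].
rewrite ler_wpM2l ?vonMangoldt_div_ge0 // fg //; apply/andP; split.
  by apply: lt_le_trans (truncnS_gt a) _; rewrite ler_nat.
by rewrite -truncn_ge_nat.
Qed.

Lemma weighted_sum_cst c t : weighted_sum (fun=> c) t = c * log_mass t.
Proof. by rewrite mulr_sumr; apply: eq_bigr => n _; rewrite mulr1 mulrC. Qed.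

Lemma weighted_sum_mono f a b : a <= b -> 0 <= b ->
  (forall n, a < n%:R <= b -> 0 <= f n) -> weighted_sum f a <= weighted_sum f b.
Proof.
move=> ab b0 f0; have := @weighted_sum_diff_le (fun=> 0) f a b ab b0 f0.
by rewrite !weighted_sum_cst !mul0r subrr subr_ge0.
Qed.

Lemma log_mass_mono a b : a <= b -> 0 <= b -> log_mass a <= log_mass b.
Proof. by move=> ab b0; apply: weighted_sum_mono => // n _; exact: ler01. Qed.

Lemma log_mass_ge0 t : 0 <= log_mass t.
Proof. by apply: sumr_ge0 => n _; rewrite mulr1 vonMangoldt_div_ge0. Qed.

Lemma ln_truncn t : 1 <= t ->
  ln (truncn t)%:R <= ln t <= ln (truncn t)%:R + (truncn t)%:R^-1.
Proof.
move=> t1; have T0 : (0 < truncn t)%N by rewrite truncn_gt0.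
have t0 : 0 <= t by lra.
have Tr : 0 < (truncn t)%:R :> R by rewrite ltr0n.
have Tt : (truncn t)%:R <= t by rewrite truncn_le.
apply/andP; split; first by rewrite ler_ln ?posrE //; lra.
rewrite -lerBlDl; apply: le_trans (ln_sub_le Tr _) _; first by lra.
rewrite -[leRHS]mul1r ler_wpM2r ?invr_ge0 ?ler0n //.
by have := truncnS_gt t; rewrite -natr1; lra.
Qed.

Lemma log_mass_bounds t : 1 <= t -> -2 <= log_mass t - ln t <= 9.
Proof.
move=> t1; have T0 : (0 < truncn t)%N by rewrite truncn_gt0.
have /andP[h1 h2] := mertens_bounds R T0; have /andP[l1 l2] := ln_truncn t1.
have : (truncn t)%:R^-1 <= 1 :> R by rewrite invf_le1 ?ltr0n // ler1n.
by rewrite log_massE; move: (_^-1) l2 => i l2 i1; apply/andP; split; lra.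
Qed.

Lemma ln_expM c t : 0 < t -> ln (expR c * t) = c + ln t.
Proof. by move=> t0; rewrite lnM ?posrE ?expR_gt0 // expRK. Qed.

Lemma ln_nat_unbounded c : exists N, forall n, (N <= n)%N -> c <= ln n%:R :> R.
Proof.
exists (truncn (expR c)).+1 => n hn.
have e : expR c <= n%:R by apply: (le_trans (ltW (truncnS_gt _))); rewrite ler_nat.
by rewrite -(expRK c) ler_ln ?posrE ?expR_gt0 // (lt_le_trans (expR_gt0 c)).
Qed.

(* Selberg's formula bounds the density of the von Mangoldt mass by twice
   its mean value. *)
Lemma log_mass_le (H e : R) : 0 <= H -> 0 < e -> exists2 a0 : R, 1 <= a0 &
  forall a b, a0 <= a <= b -> ln b - ln a <= H ->
  log_mass b - log_mass a <= 2 * (ln b - ln a) + e.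
Proof.
move=> H0 e0; have [K K0 hK] := selberg_mean_bounds R.
(* Once ln A >= Q, the terms (H + 1)^2 and K (3 + H) and the rounding of a and b to integers total
   at most e after division by ln A. *)
pose Q := (2 + (H + 1) ^+ 2 + K * (3 + H)) / e + 1.
have Q1 : 1 <= Q by rewrite lerDr divr_ge0 ?(ltW e0) // addr_ge0 ?mulr_ge0 ?addr_ge0 ?sqr_ge0 //; lra.
have [N hN] := ln_nat_unbounded Q.
exists N.+1%:R => [|a b /andP[aN ab] abH]; first by rewrite ler1n.
have a1 : 1 <= a by apply: le_trans aN; rewrite ler1n.
have b1 : 1 <= b by apply: le_trans ab.
have [a0 b0] : 0 <= a /\ 0 <= b by split; lra.
set A := truncn a; set B := truncn b.
have NA : (N < A)%N by rewrite truncn_ge_nat.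
have A0 : (0 < A)%N by apply: leq_ltn_trans NA.
have AB : (A <= B)%N by apply: le_truncn.
have hA : Q <= ln A%:R by apply: hN; exact: ltnW.
have /andP[lA1 lA2] := ln_truncn a1; have /andP[lB1 lB2] := ln_truncn b1.
rewrite -/A -/B in lA1 lA2 lB1 lB2.
(* On the range ln n >= ln A, and the convolution part of [selberg_mean] does not decrease from A to
   B. *)
have D1 : ln A%:R * (log_mass b - log_mass a) <= selberg_mean R B - selberg_mean R A.
  rewrite mulrBr -!weighted_sum_cst.
  apply: (@le_trans _ _ (weighted_sum (fun n => ln n%:R) b - weighted_sum (fun n => ln n%:R) a)).
    apply: weighted_sum_diff_le => // n /andP[an _]; apply: ler_ln_nat.
    rewrite A0 -(ler_nat R); apply: le_trans (ltW an); by rewrite truncn_le.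
  have E t : weighted_sum (fun n => ln n%:R) t = 
     \sum_(1 <= n < (truncn t).+1) Lam n * ln n%:R / n%:R.
    by apply: eq_bigr => n _; rewrite mulrAC.
  rewrite !E !selberg_meanE -/A -/B opprD addrACA lerDl subr_ge0.
  rewrite (sum_widen _ AB); apply: ler_sum_nat => d /andP[d0 _].
  case: leqP => _; last by rewrite mulr_ge0 ?vonMangoldt_div_ge0 ?sumr_ge0 // => n _; exact: vonMangoldt_div_ge0.
  rewrite ler_wpM2l ?vonMangoldt_div_ge0 //.
  rewrite /mertens (sum_widen _ (leq_div2r d AB)); apply: ler_sum => n _.
  by case: ifP => _ //; exact: vonMangoldt_div_ge0.
have := hK A B; rewrite A0 AB => /(_ isT); rewrite ler_norml => /andP[_ hKK].
have iA : A%:R^-1 <= (ln A%:R)^-1 :> R.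
  by rewrite lef_pV2 ?posrE ?ltr0n // ?ln_nat_le //; lra.
have : (ln A%:R)^-1 * ln A%:R = 1 :> R by rewrite mulVf // gt_eqF //; lra.
have Qe : (ln A%:R - 1) * e >= 2 + (H + 1) ^+ 2 + K * (3 + H).
  by rewrite -ler_pdivrMr // lerBrDr.
have {}hA : 1 <= ln A%:R :> R by lra.
have lAB : ln A%:R <= ln B%:R :> R by apply: ler_ln_nat; rewrite A0.
move: lAB iA lA2 lB2 Qe hA lA1 lB1 D1 hKK abH.
move: (log_mass b - _) (selberg_mean R B - _) (ln B%:R) (ln A%:R) (ln a) (ln b)
  (A%:R^-1) (B%:R^-1) ((ln A%:R)^-1) => M S lB lA la lb i i' j.
move=> lAB iA lA2 lB2 Qe hA lA1 lB1 D1 hKK abH jE.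
have lA0 : 0 < lA by lra.
have j0 : 0 <= j by nra.
have j1 : j <= 1 by nra.
rewrite -(ler_pM2l lA0).
have D0 : lB - lA <= (lb - la) + j by lra.
have k1 : K * (2 + (lB - lA)) <= K * (3 + H) by apply: ler_wpM2l => //; lra.
have k2 : (lB - lA) ^+ 2 <= (H + 1) ^+ 2 by rewrite ler_pXn2r ?nnegrE //; lra.
have k3 : lA * (lB - lA) <= lA * (lb - la + j) by rewrite ler_pM2l.
have k4 : lA * j = 1 by rewrite mulrC.
have k5 : lB ^+ 2 - lA ^+ 2 = (lB - lA) ^+ 2 + 2 * (lA * (lB - lA)) by ring.
rewrite [X in _ <= X]mulrDr k4 in k3; rewrite mulrBl in Qe; rewrite mulrDr mulrCA; lra.
Qed.

Lemma truncn_divn t d : 0 <= t -> (0 < d)%N -> truncn (t / d%:R) = (truncn t %/ d)%N.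
Proof.
move=> t0 d0; have dr : 0 < d%:R :> R by rewrite ltr0n.
apply: truncn_def; rewrite ler_pdivlMr // ltr_pdivrMr // -!natrM; apply/andP; split.
  by rewrite -truncn_ge_nat // leq_trunc_div.
by rewrite -truncn_lt_nat // ltn_ceil.
Qed.

(** The lower half of Selberg's formula on (X, e^h X], with ln n <= h + ln X in the Lambda ln part.
    If this interval has little mass, the convolution must supply nearly 2 h ln X, so the intervals
    (X/d, e^h X/d] have density close to 2 on average. *)
Lemma log_mass_convolution_ge : exists2 C, 0 <= C & forall h X, 0 <= h -> (0 < X)%N ->
  2 * h * ln X%:R - C * (1 + h)
    - (h + ln X%:R) * (log_mass (expR h * X%:R) - log_mass X%:R) <=
  weighted_sum (fun d => log_mass (expR h * X%:R / d%:R) - log_mass (X%:R / d%:R))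
    (expR h * X%:R).
Proof.
have [K K0 hK] := selberg_mean_bounds R.
exists (4 + 2 * K) => [|h X h0 X0]; first lra.
set y := expR h * X%:R; set Y := truncn y.
have X1 : 1 <= X%:R :> R by rewrite ler1n.
have Xy : X%:R <= y by rewrite ler_peMl ?ler0n // -expR0 ler_expR.
have y1 : 1 <= y by lra.
have y0 : 0 <= y by lra.
have Y0 : (0 < Y)%N by rewrite truncn_gt0.
have XY : (X <= Y)%N by rewrite truncn_ge_nat.
have lyE : ln y = h + ln X%:R by rewrite ln_expM ?ltr0n.
have E : selberg_mean R Y - selberg_mean R X =
    (weighted_sum (fun n => ln n%:R) y - weighted_sum (fun n => ln n%:R) X%:R) +
    weighted_sum (fun d => log_mass (y / d%:R) - log_mass (X%:R / d%:R)) y.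
  have E t : weighted_sum (fun n => ln n%:R) t =
     \sum_(1 <= n < (truncn t).+1) Lam n * ln n%:R / n%:R.
    by apply: eq_bigr => n _; rewrite mulrAC.
  rewrite !E !selberg_meanE natrK opprD addrACA; congr (_ + _).
  rewrite (sum_widen _ XY) -sumrB; apply: eq_big_nat => d /andP[d0 _].
  rewrite !log_massE !truncn_divn ?ler0n // natrK mulrBr; congr (_ - _).
  case: leqP => // Xd; rewrite divn_small // /mertens big_geq ?mulr0 //.
have := hK X Y; rewrite X0 XY => /(_ isT); rewrite E ler_norml => /andP[h1 _].
have h2 : weighted_sum (fun n => ln n%:R) y - weighted_sum (fun n => ln n%:R) X%:R <=
   ln y * (log_mass y - log_mass X%:R).
  rewrite mulrBr -!weighted_sum_cst; apply: weighted_sum_diff_le => // n /andP[Xn ny].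
  by rewrite ler_ln ?posrE //; lra.
have /andP[ly1 ly2] := ln_truncn y1; rewrite -/Y in ly1 ly2.
have lY : ln y * Y%:R^-1 <= 2.
  rewrite ler_pdivrMr ?ltr0n //; apply: le_trans (ltW (ln_sublinear _)) _; first lra.
  have := truncnS_gt y; rewrite -/Y -natr1; have : 1 <= Y%:R :> R by rewrite ler1n.
  lra.
have i1 : Y%:R^-1 <= 1 :> R by rewrite invf_le1 ?ltr0n // ler1n.
have lX := ln_nat_ge0 R X; have lY0 := ln_nat_ge0 R Y.
have lyY : ln y ^+ 2 - 4 <= ln Y%:R ^+ 2.
  move: (ln y) (ln Y%:R) (_^-1) ly1 ly2 lY i1 lY0 => u v i ? ? ? ? ?.
  have : (u - v) * (u + v) <= i * (2 * u) by apply: ler_pM; lra.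
  nra.
rewrite -lyE.
have hD : ln Y%:R - ln X%:R <= h by rewrite lyE in ly1; lra.
have k1 : K * (2 + (ln Y%:R - ln X%:R)) <= K * (2 + h) by apply: ler_wpM2l => //; lra.
have k2 : ln y ^+ 2 - ln X%:R ^+ 2 >= 2 * h * ln X%:R by rewrite lyE; nra.
have k3 : 0 <= K * h by rewrite mulr_ge0.
have k4 : (4 + 2 * K) * (1 + h) >= 4 + K * (2 + h) by nra.
lra.
Qed.

End Erdos.

(** * Nearly empty intervals *)

Section PrimeGaps.
Variable R : realType.
Local Notation Lam := (@vonMangoldt R).
Local Notation truncn := Num.truncn.
Local Notation log_mass := (@log_mass R).
Local Notation weighted_sum := (@weighted_sum R).
Implicit Types (n m d k N X Y : nat) (a b c x y z t h e s : R) (f : nat -> R).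

Definition sparse h := forall e X0, 0 < e -> exists2 X, (X0 <= X)%N &
  log_mass (expR h * X%:R) - log_mass X%:R <= e.

(** By [log_mass_bounds] an interval of logarithmic length h has mass at least h - 11; take one of
    mass at most 1. *)
Lemma sparse_le h : 0 <= h -> sparse h -> h <= 12.
Proof.
move=> h0 /(_ 1 1%N ltr01)[X X0 hX].
have X1 : 1 <= X%:R :> R by rewrite ler1n.
have y1 : 1 <= expR h * X%:R.
  by apply: le_trans X1 _; rewrite ler_peMl ?ler0n // -expR0 ler_expR.
have /andP[? _] := log_mass_bounds y1; have /andP[_ ?] := log_mass_bounds X1.
have := @ln_expM R h X%:R ltac:(lra); lra.
Qed.

(** Rounding t down to an integer keeps [log_mass t] and does not raise the mass at the right end,
    so a lower bound at integers passes to real t. *)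
Lemma not_sparse h : 0 <= h -> ~ sparse h -> exists2 e, 0 < e &
  exists2 z, 1 <= z & forall t, z <= t -> e <= log_mass (expR h * t) - log_mass t.
Proof.
move=> h0 /existsNP[e /existsNP[X0 /not_implyP[e0 hX]]]; exists e => //.
exists X0.+1%:R => [|t Xt]; first by rewrite ler1n.
have t0 : 0 <= t by apply: le_trans Xt; exact: ler0n.
set X := truncn t; have XX : (X0 <= X)%N by apply: ltnW; rewrite truncn_ge_nat.
have -> : log_mass t = log_mass X%:R by rewrite !log_massE natrK.
apply: (@le_trans _ _ (log_mass (expR h * X%:R) - log_mass X%:R)).
  by rewrite leNgt; apply/negP => /ltW ?; apply: hX; exists X.
rewrite lerD2r; apply: log_mass_mono; last by rewrite mulr_ge0 ?expR_ge0.
by rewrite ler_wpM2l ?expR_ge0 // truncn_le.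
Qed.

Lemma weighted_sum_csub c f t :
  weighted_sum (fun n => c - f n) t = c * log_mass t - weighted_sum f t.
Proof.
rewrite -weighted_sum_cst -sumrB; apply: eq_bigr => n _; exact: mulrBr.
Qed.

(** The amount by which the mass of (x/n, e^h x/n] falls short of Selberg's upper bound 2 h + e; by
    [log_mass_le] it is nonnegative when x/n is large. *)
Definition deficit h e x n : R :=
  2 * h + e - (log_mass (expR h * x / n%:R) - log_mass (x / n%:R)).

(** The constant 2 h + e sums to at most (2 h + e) ln X + O(1), while by [log_mass_convolution_ge]
    the masses sum to at least 2 h ln X - e ln X - O(1). This leaves 2 e ln X, and a third e ln X
    absorbs the constants once X is large. *)
Lemma sparse_deficit h e a : 0 < h -> 0 < e -> 1 <= a -> sparse h ->
  forall X0, exists2 X, (X0 <= X)%N &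
    weighted_sum (deficit h e X%:R) (X%:R / a) <= 3 * e * ln X%:R.
Proof.
move=> h0 e0 a1 sh X0; have [C C0 hC] := log_mass_convolution_ge R.
set c := log_mass (expR h * a).
have c0 : 0 <= c by exact: log_mass_ge0.
pose c4 := (2 * h + e) * 9 + C * (1 + h) + h * e + c * (h + ln a + 11).
have [X1 hX1] := ln_nat_unbounded (c4 / e).
have [X XX hX] := sh e (maxn X0 (maxn X1 (truncn a).+1)) e0.
move: XX; rewrite !geq_max => /and3P[X0X X1X aX]; exists X => //.
have Xa : a <= X%:R by apply: le_trans (ltW (truncnS_gt a)) _; rewrite ler_nat.
have Xr : 0 < X%:R :> R by lra.
have X1r : 1 <= X%:R :> R by lra.
have lX : c4 <= e * ln X%:R by rewrite mulrC -ler_pdivrMr // hX1.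
set y := expR h * X%:R in hX *.
have Xy : X%:R <= y by rewrite ler_peMl ?ler0n // -expR0 ler_expR ltW.
have y0 : 0 <= y by lra.
have lyE : ln y = h + ln X%:R by rewrite ln_expM.
have a0 : 0 < a by lra.
have xa : X%:R / a <= X%:R by rewrite ler_pdivrMr // ler_peMr // ltW.
have xa1 : 1 <= X%:R / a by rewrite ler_pdivlMr // mul1r.
have lxa : ln (X%:R / a) = ln X%:R - ln a by rewrite ln_div ?posrE.
set g := fun n => log_mass (y / n%:R) - log_mass (X%:R / n%:R).
have := hC h X (ltW h0); rewrite -(ltr0n R) => /(_ Xr); rewrite -/y -/g => hW.
(* For n > X/a the interval lies below e^h a, so its mass is at most c, and by Mertens' estimate
   these n have total mass at most h + ln a + 11. *)
have hg : weighted_sum g y - weighted_sum g (X%:R / a) <= c * (h + ln a + 11).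
  apply: (@le_trans _ _ (c * log_mass y - c * log_mass (X%:R / a))).
    rewrite -!weighted_sum_cst; apply: weighted_sum_diff_le => //; first by lra.
    move=> n /andP[an ny]; have n0 : 0 < n%:R :> R by apply: lt_trans an; lra.
    rewrite /g; apply: (@le_trans _ _ (log_mass (y / n%:R))).
      by rewrite gerBl; exact: log_mass_ge0.
    apply: log_mass_mono; last by rewrite mulr_ge0 ?expR_ge0 ?(ltW a0).
    rewrite ler_pdivrMr // -mulrA ler_wpM2l ?expR_ge0 //.
    by move: an; rewrite ltr_pdivrMr // mulrC => /ltW.
  rewrite -mulrBr ler_wpM2l //.
  have /andP[? _] := log_mass_bounds xa1.
  have /andP[_ ?] := @log_mass_bounds R y ltac:(lra).
  lra.
have -> : weighted_sum (deficit h e X%:R) (X%:R / a) =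
    (2 * h + e) * log_mass (X%:R / a) - weighted_sum g (X%:R / a).
  by rewrite -weighted_sum_csub.
have hm : (2 * h + e) * log_mass (X%:R / a) <= (2 * h + e) * (ln X%:R + 9).
  apply: ler_wpM2l; first by lra.
  apply: le_trans (log_mass_mono xa _) _; first by lra.
  by have /andP[_ ?] := log_mass_bounds X1r; lra.
have l0 : 0 <= ln X%:R :> R by exact: ln_ge0.
have he : (h + ln X%:R) * (log_mass y - log_mass X%:R) <= (h + ln X%:R) * e.
  by apply: ler_wpM2l => //; rewrite addr_ge0 // ltW.
rewrite /c4 in lX; nra.
Qed.

Lemma telescope_small (u : nat -> R) N s : (0 < N)%N -> u N - u 0%N <= s * N%:R ->
  exists2 j, (j < N)%N & u j.+1 - u j <= s.
Proof.
move=> N0 hu; apply: contrapT => hn.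
have big j : (j < N)%N -> s < u j.+1 - u j.
  by move=> jN; rewrite ltNge; apply/negP => h; apply: hn; exists j.
have : s * N%:R < u N - u 0%N.
  rewrite -(telescope_sumr u (leq0n N)) mulr_natr -[N in s *+ N]subn0 -sumr_const_nat.
  by apply: ltr_sum_nat => // j /andP[_ /big].
by move/(le_lt_trans hu); rewrite ltxx.
Qed.

(** From n, step down to some n' with deficit at most s and n/n' between e^(h/10) and e^(12h/10),
    and repeat until a value at most e^(12h/10) z is reached. Each step covers (e^h x/n, e^h x/n']
    with density at least 3/2. *)
Lemma dense_chain h e s a x z Z : 0 < h -> 0 < e -> 0 < s -> s <= h / 50 ->
  1 <= a -> 1 <= z -> 0 < x -> Z <= x / a ->
  (forall b c, a <= b <= c -> ln c - ln b <= h ->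
     log_mass c - log_mass b <= 2 * (ln c - ln b) + e) ->
  (forall t, z <= t -> expR (11 / 10 * h) * t <= Z -> exists2 n,
     t < n%:R <= expR (11 / 10 * h) * t & deficit h e x n <= s) ->
  forall n, z < n%:R <= Z -> exists m, [/\ (0 < m)%N, m%:R <= expR (12 / 10 * h) * z &
    3 / 2 * (ln n%:R - ln m%:R) <=
      log_mass (expR h * x / m%:R) - log_mass (expR h * x / n%:R)].
Proof.
move=> h0 e0 s0 sh a1 z1 x0 Zx ub good n; elim/ltn_ind: n => n IH /andP[zn nZ].
have n0 : 0 < n%:R :> R by lra.
have [nz|nz] := leP n%:R (expR (12 / 10 * h) * z).
  by exists n; rewrite -(ltr0n R) n0 !subrr mulr0.
(* The window (t, e^(11h/10) t] ends at e^(-h/10) n, which keeps ln n - ln n' large against the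
   error s. *)
pose t := expR (- (12 / 10 * h)) * n%:R.
have t0 : 0 < t by rewrite mulr_gt0 ?expR_gt0.
have zt : z <= t.
  by rewrite /t -(ler_pM2l (expR_gt0 (12 / 10 * h))) mulrA -expRD subrr expR0 mul1r ltW.
have lt : ln t = ln n%:R - 12 / 10 * h by rewrite ln_expM // addrC.
have ltn : ln (expR (11 / 10 * h) * t) = ln n%:R - h / 10 by rewrite ln_expM // lt; field.
have tn : expR (11 / 10 * h) * t < n%:R.
  by rewrite -ltr_ln ?posrE ?mulr_gt0 ?expR_gt0 // ltn; lra.
have [n' /andP[tn' n't] gn'] := good t zt (le_trans (ltW tn) nZ).
have n'0 : 0 < n'%:R :> R by lra.
have n'n : (n' < n)%N by rewrite -(ltr_nat R); lra.
have [|m [m0 mz hm]] := IH n' n'n; first by apply/andP; split; lra.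
exists m; split => //.
have l1 : ln n%:R - 12 / 10 * h < ln n'%:R by rewrite -lt ltr_ln ?posrE.
have l2 : ln n'%:R <= ln n%:R - h / 10 by rewrite -ltn ler_ln ?posrE ?mulr_gt0 ?expR_gt0.
suff : 3 / 2 * (ln n%:R - ln n'%:R) <=
    log_mass (expR h * x / n'%:R) - log_mass (expR h * x / n%:R) by lra.
move: gn'; rewrite /deficit => gn'.
have a0 : 0 < a by lra.
have y0 : 0 < expR h * x by rewrite mulr_gt0 ?expR_gt0.
have xn' : 0 < x / n'%:R by rewrite divr_gt0.
have yn : 0 < expR h * x / n%:R by rewrite divr_gt0.
have xa : a <= x / n'%:R.
  rewrite ler_pdivlMr // mulrC -ler_pdivlMr //; lra.
have lyE : ln (expR h * x / n%:R) = h + ln x - ln n%:R by rewrite ln_div ?posrE // ln_expM.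
have lxE : ln (x / n'%:R) = ln x - ln n'%:R by rewrite ln_div ?posrE.
(* If the intervals of n and n' overlap, the overlap has mass at most 2 (h - ln(n/n')) + e, and
   removing it leaves at least 2 ln(n/n') - s. Otherwise the whole interval of n' counts, and its
   mass 2 h + e - s exceeds 3/2 of the largest possible step 12h/10. *)
have [c1|c1] := leP (x / n'%:R) (expR h * x / n%:R).
  have := ub (x / n'%:R) (expR h * x / n%:R); rewrite xa c1 lyE lxE => /(_ isT ltac:(lra)).
  lra.
have := log_mass_mono (ltW c1) (ltW xn').
lra.
Qed.

(** If not, every far interval of logarithmic length 11h/10 has mass at least d. Some block (z, Z]
    of logarithmic length L has so little total deficit that each such interval in it contains an n
    with deficit at most s, and the resulting chain across the block contradicts
    [log_mass_bounds]. *)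
Lemma sparse_step h : 0 < h -> sparse h -> sparse (11 / 10 * h).
Proof.
move=> h0 sh; apply: contrapT => nsh.
have [d d0 [z0 z01 hd]] := not_sparse (ltac:(lra) : 0 <= 11 / 10 * h) nsh.
(* The chain will span more than L - 23h/10 > 22 in logarithm, whereas density 3/2 and a total
   Mertens error of 11 allow at most 22. *)
have [L LE] : exists L, L = 23 + 3 * h by eexists.
have L0 : 0 < L by lra.
have [s sE] : exists s, s = h / 50 by eexists.
have s0 : 0 < s by lra.
(* A window of mass at least d with all deficits above s would cost s d = 7 e L, more than the 6 e L
   available in the chosen block. *)
have [e e0 eE] : exists2 e, 0 < e & e * (7 * L) = s * d.
  exists (s * d / (7 * L)); first by apply: divr_gt0; [exact: mulr_gt0|lra].
  by rewrite divfK // gt_eqF //; lra.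
have [a a1 ub] := @log_mass_le R h e (ltW h0) e0.
(* This makes J L at least half of ln x, so that 3 e ln x <= 6 e L J and some block has deficit at
   most 6 e L. *)
have [X1 hX1] := ln_nat_unbounded (2 * (ln a + ln z0 + L) + 2 * L).
have [X] := sparse_deficit h0 e0 a1 sh (maxn 1 X1).
rewrite geq_max => /andP[X0 X1X] hX.
have {hX1 X1X} hX1 := hX1 _ X1X.
set x := X%:R in hX hX1 *; have x0 : 0 < x by rewrite ltr0n.
have a0 : 0 < a by lra.
have la := ln_ge0 a1; have lz := ln_ge0 z01.
have lxa : ln (x / a) = ln x - ln a by rewrite ln_div ?posrE.
have D0 n : (0 : R) < n%:R <= x / a -> 0 <= deficit h e x n.
  case/andP=> n0 nx; have y0 : 0 < expR h * x by rewrite mulr_gt0 ?expR_gt0.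
  have xa : a <= x / n%:R by rewrite ler_pdivlMr // mulrC -ler_pdivlMr.
  have lE : ln (expR h * x / n%:R) = h + ln (x / n%:R).
    by rewrite !ln_div ?posrE // ln_expM // addrA.
  have := ub (x / n%:R) (expR h * x / n%:R); rewrite xa lE /deficit => /(_ _ _).
  have -> : x / n%:R <= expR h * x / n%:R.
    by rewrite ler_wpM2r ?invr_ge0 ?(ltW n0) // ler_peMl ?(ltW x0) // -expR0 ler_expR ltW.
  by move=> /(_ isT ltac:(lra)); lra.
pose P := weighted_sum (deficit h e x).
have Pmono b c : 0 <= b -> b <= c -> c <= x / a -> P b <= P c.
  move=> b0 bc cx; apply: weighted_sum_mono => // [|n /andP[bn nc]]; first lra.
  by apply: D0; apply/andP; split; lra.
pose u j : R := expR (j%:R * L) * z0.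
have u0 j : 0 < u j by rewrite mulr_gt0 ?expR_gt0 //; lra.
have luE j : ln (u j) = j%:R * L + ln z0 by rewrite ln_expM //; lra.
have uS j : u j.+1 = expR L * u j by rewrite /u mulrA -expRD -natr1 mulrDl mul1r addrC.
pose q := (ln x - ln a - ln z0) / L; pose J := truncn q.
have q0 : 0 <= q by rewrite divr_ge0 // ?(ltW L0) //; lra.
have qL : q * L = ln x - ln a - ln z0 by rewrite divfK // gt_eqF.
have Jq : J%:R <= q by rewrite truncn_le.
have qJ : q < J%:R + 1 by rewrite natr1 truncnS_gt.
have JL : J%:R * L <= ln x - ln a - ln z0 by rewrite -qL ler_pM2r.
have JL2 : ln x - ln a - ln z0 < J%:R * L + L by rewrite -qL -[X in _ + X]mul1r -mulrDl ltr_pM2r.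
have J0 : (0 < J)%N.
  by rewrite -(ltr0n R) -(pmulr_lgt0 _ L0); lra.
have uJ : u J <= x / a.
  by rewrite -ler_ln ?posrE ?divr_gt0 // luE lxa; lra.
have umono j : (j <= J)%N -> u j <= u J.
  by move=> jJ; rewrite -ler_ln ?posrE // !luE lerD2r ler_pM2r // ler_nat.
have [j jJ hj] : exists2 j, (j < J)%N & P (u j.+1) - P (u j) <= 6 * e * L.
  apply: (@telescope_small (fun j => P (u j))) => //.
  have : 0 <= P (u 0%N).
    have := Pmono 0 (u 0%N) (lexx _) (ltW (u0 _)) (le_trans (umono _ (leq0n J)) uJ).
    by rewrite {1}/P /weighted_sum truncn0 big_geq.
  have := Pmono _ _ (ltW (u0 J)) uJ (lexx _).
  have : 6 * e * L * J%:R >= 3 * e * ln x.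
    have -> : 6 * e * L * J%:R = 3 * e * (2 * (J%:R * L)) by ring.
    by apply: ler_wpM2l; lra.
  have : P (x / a) <= 3 * e * ln x := hX.
  move=> /= ? ? ? ?; lra.
set z := u j in hj; set Z := u j.+1 in hj.
have z0z : z0 <= z.
  rewrite -ler_ln ?posrE ?u0 //; last by lra.
  by rewrite /z luE lerDr mulr_ge0 ?ler0n // ltW.
have Zx : Z <= x / a by apply: le_trans uJ; exact: umono.
have lZ : ln Z = L + ln z by rewrite /Z uS ln_expM.
have zp : 0 < z by exact: u0.
have Zp : 0 < Z by exact: u0.
have good t : z <= t -> expR (11 / 10 * h) * t <= Z -> exists2 n,
     t < n%:R <= expR (11 / 10 * h) * t & deficit h e x n <= s.
  move=> zt tZ; apply: contrapT => hn.
  have t0 : 0 < t by lra.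
  set t' := expR (11 / 10 * h) * t in tZ hn *.
  have tt' : t <= t'.
    by rewrite /t' ler_peMl ?(ltW t0) //; have := expR_ge1Dx (11 / 10 * h); lra.
  have : s * log_mass t' - s * log_mass t <= P t' - P t.
    rewrite -!weighted_sum_cst; apply: weighted_sum_diff_le => //; first lra.
    by move=> n tn; rewrite leNgt; apply/negP => /ltW ?; apply: hn; exists n.
  have := Pmono z t (ltW zp) zt (le_trans tt' (le_trans tZ Zx)).
  have := Pmono t' Z (le_trans (ltW t0) tt') tZ Zx.
  have : s * d <= s * (log_mass t' - log_mass t) by rewrite ler_pM2l // hd //; lra.
  have : 0 < e * L by rewrite mulr_gt0.
  lra.
(* The last window of the block supplies an n close to Z, the top of the chain. *)
pose t := expR (- (11 / 10 * h)) * Z.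
have t0 : 0 < t by rewrite mulr_gt0 ?expR_gt0.
have ltE : ln t = L + ln z - 11 / 10 * h by rewrite ln_expM // lZ; ring.
have zt : z <= t by rewrite -ler_ln ?posrE // ltE; lra.
have tZ : expR (11 / 10 * h) * t = Z by rewrite /t mulrA -expRD subrr expR0 mul1r.
have [|n /andP[tn nZ] _] := good t zt; first by rewrite tZ.
rewrite tZ in nZ.
have n0 : 0 < n%:R :> R by lra.
have [|m [m0 mz hm]] := @dense_chain h e s a x z Z h0 e0 s0 (ltac:(lra)) a1 (le_trans z01 z0z) x0 Zx ub good n.
  by apply/andP; split; lra.
have mr : 0 < m%:R :> R by rewrite ltr0n.
have lm : ln m%:R <= 12 / 10 * h + ln z.
  have yz : 0 < expR (12 / 10 * h) * z by exact: mulr_gt0 (expR_gt0 _) zp.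
  by rewrite -ln_expM // ler_ln ?posrE.
have ln' : ln t < ln n%:R by rewrite ltr_ln ?posrE.
have y0 : 0 < expR h * x by rewrite mulr_gt0 ?expR_gt0.
have yn1 b : 0 < b -> b <= Z -> 1 <= expR h * x / b.
  move=> b0 bZ; rewrite ler_pdivlMr // mul1r; apply: le_trans bZ _; apply: le_trans Zx _.
  apply: (@le_trans _ _ x); first by rewrite ler_pdivrMr // ler_peMr // ltW.
  by rewrite ler_peMl ?(ltW x0) // -expR0 ler_expR ltW.
have mZ : m%:R <= Z.
  by rewrite -ler_ln ?posrE // lZ; lra.
have /andP[_ b1] := log_mass_bounds (yn1 _ mr mZ).
have /andP[b2 _] := log_mass_bounds (yn1 _ n0 nZ).
move: b1 b2; rewrite !ln_div ?posrE // => b1 b2.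
lra.
Qed.

End PrimeGaps.

(** * Primes in short intervals *)

Section PrimesInShortIntervals.
Variable R : realType.
Local Notation Lam := (@vonMangoldt R).
Local Notation truncn := Num.truncn.
Local Notation log_mass := (@log_mass R).
Implicit Types (n m d k N X Y p r : nat) (a b c x y z t h e s : R).

(** Each use of [sparse_step] adds at least h/10 to the length, so more than 120/h uses lead past
    12, against [sparse_le]. *)
Lemma sparse_false h : 0 < h -> ~ sparse h.
Proof.
move=> h0 sh.
have it k : exists2 g, h + k%:R * (h / 10) <= g & sparse g.
  elim: k => [|k [g hg sg]]; first by exists h; rewrite ?mul0r ?addr0.
  have k0 : 0 <= k%:R * (h / 10) by rewrite mulr_ge0 ?ler0n //; lra.
  exists (11 / 10 * g); last by apply: sparse_step => //; lra.
  by rewrite -natr1 mulrDl; lra.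
have [g hg sg] := it (truncn (120 / h)).+1.
have g0 : 0 <= g.
  by apply: le_trans hg; rewrite addr_ge0 ?mulr_ge0 ?ler0n //; lra.
have := sparse_le g0 sg.
have := truncnS_gt (120 / h); rewrite ltr_pdivrMr // => k1; lra.
Qed.

Lemma sum_prime_powers_le p N : prime p -> (0 < N)%N ->
  \sum_(1 <= m < N.+1 | primes m == [:: p]) Lam m <= ln N%:R.
Proof.
move=> pp N0; rewrite (eq_bigr (fun=> ln p%:R)); last first.
  by move=> m /eqP E; rewrite /vonMangoldt E.
rewrite -big_filter; set s := [seq _ <- _ | _].
have -> : \sum_(i <- s) ln p%:R = ln p%:R *+ size s :> R.
  by rewrite big_const_seq count_predT iter_addr_0.
have ss : (size s <= trunc_log p N)%N.
  have -> : trunc_log p N = size [seq (p ^ k)%N | k <- iota 1 (trunc_log p N)].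
    by rewrite size_map size_iota.
  apply: uniq_leq_size.
    exact/filter_uniq/iota_uniq.
  move=> m; rewrite mem_filter mem_index_iota => /and3P[/eqP E m0 mN].
  have [_ mE] := primes1_pfactor E; apply/mapP; exists (logn p m) => //.
  rewrite mem_iota add1n ltnS trunc_log_max ?prime_gt1 -?mE // andbT.
  by rewrite logn_gt0 E inE.
rewrite -lnXn ?ltr0n ?prime_gt0 // -natrX; apply: ler_ln_nat.
rewrite expn_gt0 prime_gt0 //= (leq_trans _ (trunc_logP (prime_gt1 pp) N0)) //.
by rewrite leq_exp2l ?prime_gt1.
Qed.

(** A non-prime m with nonzero Lambda(m) is p^k with k >= 2, so p^2 <= N and p <= r;
    [sum_prime_powers_le] bounds the contribution of each p. *)
Lemma sum_proper_prime_powers_le N r : (0 < N)%N -> (N < r.+1 ^ 2)%N ->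
  \sum_(1 <= m < N.+1 | ~~ prime m) Lam m <= r%:R * ln N%:R.
Proof.
move=> N0 Nr.
apply: (@le_trans _ _ (\sum_(1 <= p < r.+1)
    (if prime p then \sum_(1 <= m < N.+1 | primes m == [:: p]) Lam m else 0))); last first.
  have -> : r%:R * ln N%:R = \sum_(1 <= p < r.+1) ln N%:R :> R.
    by rewrite sumr_const_nat subn1 /= mulr_natl.
  apply: ler_sum => p _; case: ifP => pp; first exact: sum_prime_powers_le.
  exact: ln_nat_ge0.
rewrite [leRHS](eq_bigr (fun p => \sum_(1 <= m < N.+1)
   (if prime p && (primes m == [:: p]) then Lam m else 0))); last first.
  by move=> p _; case: (prime p) => /=; rewrite ?big1_eq -?big_mkcond.
rewrite exchange_big /= big_mkcond; apply: ler_sum_nat => m /andP[m0 mN].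
have T0 : 0 <= \sum_(1 <= p < r.+1) (if prime p && (primes m == [:: p]) then Lam m else 0).
  by apply: sumr_ge0 => p _; case: ifP => // _; exact: vonMangoldt_ge0.
case: ifP => // npm.
have [L0|L0] := eqVneq (Lam m) 0; first by rewrite {1}L0.
have [p E] : exists p, primes m = [:: p].
  by move: L0; rewrite /vonMangoldt; case: (primes m) => [|p [|q s]]; rewrite ?eqxx // => _; exists p.
have [pp mE] := primes1_pfactor E.
have pr : p \in index_iota 1 r.+1.
  rewrite mem_index_iota prime_gt0 //= -(@ltn_exp2r _ _ 2 isT).
  rewrite ltnS in mN; apply: leq_ltn_trans Nr; apply: leq_trans mN; rewrite [leqRHS]mE leq_exp2l ?(prime_gt1 pp) //.
  case: (logn p m) mE => [|[|k]] // mE; last by rewrite mE expn1 pp in npm.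
  by rewrite mE in E.
rewrite (bigD1_seq p) ?iota_uniq //= pp E eqxx /= lerDl.
by apply: sumr_ge0 => q _; case: ifP => // _; exact: vonMangoldt_ge0.
Qed.

(** By [sparse_false] at ln(1 + e), the interval (n, (1 + e) n] has mass at least some d > 0.
    Without primes, this mass comes from proper prime powers and is at most sqrt(Y) ln Y / n with Y
    = floor((1 + e) n), which is eventually below d. *)
Lemma prime_in_short_interval e : 0 < e -> exists N, forall n, (N <= n)%N ->
  exists q, [/\ prime q, (n < q)%N & q%:R <= (1 + e) * n%:R].
Proof.
move=> e0; have h0 : 0 < ln (1 + e) by rewrite ln_gt0 // ltrDl.
have [d d0 [z z1 hd]] := not_sparse (ltW h0) (sparse_false h0).
have eE : expR (ln (1 + e)) = 1 + e by rewrite lnK // posrE addr_gt0.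
rewrite eE in hd => {eE}.
pose B := 16 * (1 + e) ^+ 2 / d ^+ 2.
exists (maxn 1 (maxn (truncn z).+1 (truncn (B ^+ 2)).+1)) => n.
rewrite !geq_max => /and3P[n0 zn Bn].
have {}zn : z <= n%:R by apply: le_trans (ltW (truncnS_gt z)) _; rewrite ler_nat.
have {}Bn : B ^+ 2 < n%:R by apply: lt_le_trans (truncnS_gt _) _; rewrite ler_nat.
have n1 : 1 <= n%:R :> R by rewrite ler1n.
apply: contrapT => noq.
set y := (1 + e) * n%:R in noq; set Y := truncn y.
have ny : n%:R <= y by rewrite /y ler_peMl ?ler0n // lerDl ltW.
have y1 : 1 <= y by lra.
have y0 : 0 <= y by lra.
have Y0 : (0 < Y)%N by rewrite truncn_gt0.
have Yy : Y%:R <= y by rewrite truncn_le.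
have Y1 : 1 <= Y%:R :> R by rewrite ler1n.
pose r := truncn (Num.sqrt Y%:R : R).
have rY : (Y < r.+1 ^ 2)%N.
  rewrite -(ltr_nat R) natrX -[ltLHS]sqr_sqrtr ?ler0n // ltr_pXn2r ?nnegrE ?sqrtr_ge0 ?ler0n //.
  exact: truncnS_gt.
have rs : r%:R <= Num.sqrt Y%:R :> R by rewrite truncn_le sqrtr_ge0.
have h1 : log_mass y - log_mass n%:R <= n%:R^-1 * (r%:R * ln Y%:R).
  apply: le_trans (ler_wpM2l _ (sum_proper_prime_powers_le Y0 rY)); last first.
    by rewrite invr_ge0 ler0n.
  rewrite weighted_sum_sub // natrK -/Y mulr_sumr big_mkcond [leRHS]big_mkcond /=.
  rewrite [leRHS](big_cat_nat (n := n.+1)) //=; last by rewrite ltnS truncn_ge_nat.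
  rewrite -[leLHS]add0r; apply: lerD.
    apply: sumr_ge0 => m _; case: ifP => // _.
    by rewrite mulr_ge0 ?invr_ge0 ?ler0n ?vonMangoldt_ge0.
  apply: ler_sum_nat => m /andP[nm mY]; rewrite mulr1.
  have -> : ~~ prime m.
    apply/negP => pm; apply: noq; exists m; split => //.
    by rewrite -truncn_ge_nat.
  have nmr : n%:R <= m%:R :> R by rewrite ler_nat ltnW.
  have mi : m%:R^-1 <= n%:R^-1 :> R by rewrite lef_pV2 ?posrE //; lra.
  by rewrite mulrC; exact: ler_wpM2r (vonMangoldt_ge0 R m) _ _ mi.
have h2 := hd n%:R zn; rewrite -/y in h2.
have h3 : d * n%:R <= Num.sqrt Y%:R * ln Y%:R.
  rewrite -ler_pdivlMr; last by lra.
  apply: le_trans h2 _; apply: le_trans h1 _; rewrite mulrC ler_wpM2r ?invr_ge0 ?ler0n //.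
  by rewrite ler_wpM2r // ln_nat_ge0.
have h4 := sqr_ln1D_le Y1.
have s1 : Num.sqrt Y%:R ^+ 2 = Y%:R :> R by rewrite sqr_sqrtr ?ler0n.
have s2 := sqrtr_ge0 (Y%:R : R).
have l0 := ln_nat_ge0 R Y.
have s3 : Num.sqrt n%:R ^+ 2 = n%:R :> R by rewrite sqr_sqrtr ?ler0n.
have s4 := sqrtr_ge0 (n%:R : R).
have B0 : 0 <= B by apply: divr_ge0; rewrite ?sqr_ge0 // mulr_ge0 ?sqr_ge0.
have Bs : B < Num.sqrt n%:R by rewrite -(ltr_pXn2r (isT : (0 < 2)%N)) ?nnegrE // s3.
have BE : B * d ^+ 2 = 16 * (1 + e) ^+ 2 by rewrite /B divfK // expf_neq0 // gt_eqF.
(* squaring [h3]: d^2 n^2 <= Y ln^2 Y <= 16 Y^(3/2) <= 16 (1 + e)^2 n^(3/2) *)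
have sY : Num.sqrt Y%:R <= (1 + e) * Num.sqrt n%:R :> R.
  rewrite -(ler_pXn2r (isT : (0 < 2)%N)) ?nnegrE ?mulr_ge0 //; last by lra.
  rewrite exprMn s1 s3; apply: le_trans Yy _; rewrite /y ler_wpM2r ?ler0n //; nra.
move: (Num.sqrt Y%:R) (Num.sqrt n%:R) (ln Y%:R) (B) s1 s2 l0 s3 s4 B0 Bs BE sY h3 h4 => u v l b s1 s2 l0 s3 s4 B0 Bs BE sY h3 h4.
have k1 : (d * n%:R) ^+ 2 <= (u * l) ^+ 2.
  by rewrite ler_pXn2r ?nnegrE ?mulr_ge0 ?ler0n // ltW.
have k2 : (u * l) ^+ 2 <= Y%:R * (16 * u).
  rewrite exprMn s1 ler_wpM2l ?ler0n //; nra.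
have k3 : Y%:R * (16 * u) <= ((1 + e) * n%:R) * (16 * ((1 + e) * v)).
  by apply: ler_pM => //; rewrite ?mulr_ge0 ?ler0n //; lra.
have k4 : ((1 + e) * n%:R) * (16 * ((1 + e) * v)) = b * d ^+ 2 * (n%:R * v) by rewrite BE; ring.
have k5 : b * d ^+ 2 * (n%:R * v) < v * d ^+ 2 * (n%:R * v).
  by rewrite ltr_pM2r ?mulr_gt0 ?ltr_pM2r ?exprn_gt0 //; lra.
have k6 : v * d ^+ 2 * (n%:R * v) = (d * n%:R) ^+ 2 by rewrite -s3; ring.
lra.
Qed.

End PrimesInShortIntervals.

(** * Trading primes *)

Lemma prod_seq_gt0 (s : seq nat) (F : nat -> nat) :
  {in s, forall q, 0 < F q}%N -> (0 < \prod_(q <- s) F q)%N.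
Proof. by move=> h; rewrite big_seq; apply: prodn_cond_gt0 => q /h. Qed.

Lemma totient_prod_primes (s : seq nat) : uniq s -> all prime s ->
  totient (\prod_(q <- s) q) = (\prod_(q <- s) q.-1)%N.
Proof.
elim: s => [|q s IH] /=; first by rewrite !big_nil.
case/andP=> qs us /andP[pq ps]; rewrite !big_cons totient_coprime ?IH //.
  by rewrite totient_prime.
rewrite coprime_sym big_seq; elim/big_rec: _ => [|r x rs cx]; first exact: coprime1n.
rewrite coprimeMl cx andbT coprime_sym prime_coprime // dvdn_prime2 ?pq ?(allP ps r rs) //.
by apply: contraNneq qs => ->.
Qed.

(** Here t is n over its radical; the same cofactor appears in phi(n), as phi(q^k) = q^(k-1) (q -
    1). *)
Lemma totient_radical n : (0 < n)%N -> exists2 t, (0 < t)%N &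
  n = (t * \prod_(q <- primes n) q)%N /\ totient n = (t * \prod_(q <- primes n) q.-1)%N.
Proof.
move=> n0; exists (\prod_(q <- primes n) q ^ (logn q n).-1)%N.
  by apply: prod_seq_gt0 => q; rewrite mem_primes expn_gt0 => /andP[/prime_gt0 ->].
split; last first.
  by rewrite totientE // -big_split; apply: eq_bigr => q _ /=; rewrite mulnC.
rewrite {1}(prod_prime_decomp n0) prime_decompE big_map -big_split /=.
apply: eq_big_seq => q; rewrite -logn_gt0 => l0.
by rewrite -expnSr prednK.
Qed.

(** For u <= m one has u/(u - 1) >= m/(m - 1); the second inequality is the product over U, cleared
    of denominators. [prod_above_pivot] is the reverse for w > m. *)
Lemma prod_below_pivot m (U : seq nat) : all (fun u => 1 < u <= m)%N U ->
  (\prod_(u <- U) u.-1 <= m.-1 ^ size U)%N /\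
  (\prod_(u <- U) u.-1 * m ^ size U <= \prod_(u <- U) u * m.-1 ^ size U)%N.
Proof.
elim: U => [|u U IH] /=; first by rewrite !big_nil.
case/andP=> /andP[u1 um] /IH[I1 I2]; rewrite !big_cons !expnS; split.
  by apply: leq_mul => //; lia.
rewrite [leqLHS]mulnACA [leqRHS]mulnACA; apply: leq_mul => //; nia.
Qed.

Lemma prod_above_pivot m (W : seq nat) : (1 < m)%N -> all (fun w => m < w)%N W ->
  (m.-1 ^ size W <= \prod_(w <- W) w.-1)%N /\
  (\prod_(w <- W) w * m.-1 ^ size W <= \prod_(w <- W) w.-1 * m ^ size W)%N.
Proof.
move=> m1; elim: W => [|w W IH] /=; first by rewrite !big_nil.
case/andP=> mw /IH[I1 I2]; rewrite !big_cons !expnS; split.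
  by apply: leq_mul => //; lia.
rewrite [leqLHS]mulnACA [leqRHS]mulnACA; apply: leq_mul => //; nia.
Qed.

Lemma prod_pred_pivot m (U W : seq nat) : (1 < m)%N ->
  all (fun u => 1 < u <= m)%N U -> all (fun w => m < w)%N W -> (size U <= size W)%N ->
  (\prod_(u <- U) u.-1 <= \prod_(w <- W) w.-1)%N.
Proof.
move=> m1 hU hW UW; have [a _] := prod_below_pivot hU; have [b _] := prod_above_pivot m1 hW.
by apply: leq_trans a _; apply: leq_trans b; rewrite leq_pexp2l //; lia.
Qed.

Lemma prod_ratio_pivot m (U W : seq nat) : (1 < m)%N ->
  all (fun u => 1 < u <= m)%N U -> all (fun w => m < w)%N W -> (size W <= size U)%N ->
  (\prod_(u <- U) u.-1 * \prod_(w <- W) w <= \prod_(u <- U) u * \prod_(w <- W) w.-1)%N.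
Proof.
move=> m1 hU hW UW; have [_ a] := prod_below_pivot hU; have [_ b] := prod_above_pivot m1 hW.
have k0 : (0 < m ^ size U * m.-1 ^ size W)%N by rewrite muln_gt0 !expn_gt0; lia.
rewrite -(leq_pmul2r k0) mulnACA [leqRHS]mulnACA.
apply: (@leq_trans (\prod_(u <- U) u * m.-1 ^ size U * (\prod_(w <- W) w.-1 * m ^ size W))).
  exact: leq_mul.
rewrite [leqLHS]mulnACA [leqRHS]mulnACA leq_mul2l -(subnKC UW) !expnD.
apply/orP; right.
have : (m.-1 ^ (size U - size W) <= m ^ (size U - size W))%N.
  by case: (_ - _)%N => // k; rewrite leq_exp2r //; lia.
set a1 := (m.-1 ^ (_ - _))%N; set b1 := (m ^ (_ - _))%N; set c1 := (m.-1 ^ _)%N; set d1 := (m ^ _)%N => h.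
by rewrite mulnAC [leqRHS]mulnAC [(d1 * c1)%N]mulnC leq_mul2l h orbT.
Qed.

(* Primes [U] are traded for primes [W], with [t] the cofactor of the new
   integer over its radical. *)
Lemma trade_primes p p1 p2 t (U W : seq nat) :
  (2 < p)%N -> (p < p1)%N -> (p1 < p2)%N -> (p2 < p.*2.-1)%N -> (0 < t)%N ->
  uniq U -> uniq W -> {in U, forall u, 1 < u}%N ->
  {in U, forall u, [|| u < p, u == p1 | u == p2]}%N ->
  {in W, forall w, (w == p) || (p2 < w)}%N ->
  (t * \prod_(w <- W) w.-1 <= \prod_(u <- U) u.-1)%N ->
  (\prod_(u <- U) u < t * \prod_(w <- W) w)%N ->
  exists r, (p1 * p2 < p * r)%N && (p.-1 * r.-1 <= p1.-1 * p2.-1)%N.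
Proof.
move=> p3 pp1 pp2 p2p t0 uU uW U1 hU hW phi big.
have m1 : (1 < p2)%N by lia.
have aU : all (fun u => 1 < u <= p2)%N U.
  by apply/allP => u uU'; have := hU u uU'; have := U1 u uU'; lia.
have U0 : (0 < \prod_(u <- U) u.-1)%N by apply: prod_seq_gt0 => u /U1; lia.
(* Comparing the two hypotheses eliminates t: the product of q/(q - 1) is larger over W than over
   U. *)
have ratio : (\prod_(u <- U) u * \prod_(w <- W) w.-1 <
    \prod_(u <- U) u.-1 * \prod_(w <- W) w)%N.
  have W0 : (0 < \prod_(w <- W) w.-1)%N by apply: prod_seq_gt0 => w /hW; lia.
  by move: big phi U0 W0; move: (\prod_(u <- U) u)%N (\prod_(u <- U) u.-1)%N
    (\prod_(w <- W) w)%N (\prod_(w <- W) w.-1)%N => A A' B B' big phi U0 W0; nia.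
(* If p is not in W, all of W exceeds p_2. With |W| <= |U| this contradicts [ratio]; with |W| > |U|,
   all but one element of W already give a product of w - 1 at least that of U, and the remaining
   factor is at least 2. *)
have [pW|pW] := boolP (p \in W); last first.
  have aW : all (fun w => p2 < w)%N W.
    apply/allP => w wW; have := hW w wW.
    by case/orP => // /eqP E; rewrite -E wW in pW.
  have [UW|UW] := leqP (size W) (size U).
    by have := prod_ratio_pivot m1 aU aW UW; rewrite leqNgt ratio.
  have := prod_pred_pivot m1 aU (W := behead W).
  case: W hW aW UW phi {uW big ratio pW} => // w W hW /= /andP[wp aW] UW phi /(_ aW UW).
  rewrite big_cons in phi; move: phi U0.
  move: (\prod_(u <- U) u.-1)%N (\prod_(w <- W) w.-1)%N => A B ? ? ?.
  have : (2 * B <= w.-1 * B)%N by rewrite leq_mul2r; lia.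
  have : (w.-1 * B <= t * (w.-1 * B))%N by rewrite leq_pmull.
  lia.
have PW := perm_to_rem pW; set W' := rem p W in PW.
have aW : all (fun w => p2 < w)%N W'.
  apply/allP => w; rewrite mem_rem_uniq // inE => /andP[/= wp wW].
  by have := hW w wW; rewrite (negPf wp).
have W'0 : (0 < \prod_(w <- W') w.-1)%N.
  by apply: prod_seq_gt0 => w /(allP aW); lia.
move: phi big ratio; rewrite !(perm_big _ PW) !big_cons => phi big ratio.
have cmp := prod_pred_pivot m1 _ aW.
(* Here too an extra factor, p - 1 >= 2, makes phi too large. *)
have [UW|UW] := leqP (size U) (size W').
  have := cmp U aU UW; move: phi W'0.
  move: (\prod_(u <- U) u.-1)%N (\prod_(w <- W') w.-1)%N => A B phi' B0 AB.
  have h1 : (2 * B <= p.-1 * B)%N by rewrite leq_mul2r; lia.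
  have h2 : (p.-1 * B <= t * (p.-1 * B))%N by rewrite leq_pmull.
  by have h3 := leq_trans h1 (leq_trans h2 phi'); exfalso; lia.
have [UW2|UW2] := ltnP (size W').+1 (size U).
  exfalso; case: U UW2 aU ratio {uU U1 hU U0 phi big UW} => // u [//|v U] /= UW.
  case/and3P=> /andP[u1 up] /andP[v1 vp] aU; rewrite !big_cons.
  have := prod_ratio_pivot m1 aU aW UW.
  move: (\prod_(u <- U) u)%N (\prod_(u <- U) u.-1)%N
    (\prod_(w <- W') w)%N (\prod_(w <- W') w.-1)%N => A A' B B' h ratio.
  (* Two elements of U outweigh p: (p_2/(p_2 - 1))^2 >= p/(p - 1), because p_2 < 2 p - 1. *)
  have k : (u.-1 * v.-1 * p <= u * v * p.-1)%N.
    have k1 : (u.-1 * p2 <= u * p2.-1)%N by nia.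
    have k2 : (v.-1 * p2 <= v * p2.-1)%N by nia.
    have k3 : (p2.-1 * p2.-1 * p <= p2 * p2 * p.-1)%N by nia.
    have p20 : (0 < p2 * p2)%N by nia.
    rewrite -(leq_pmul2r p20).
    have -> : (u.-1 * v.-1 * p * (p2 * p2) = (u.-1 * p2) * (v.-1 * p2) * p)%N by nia.
    apply: (@leq_trans ((u * p2.-1) * (v * p2.-1) * p)).
      by rewrite leq_mul2r leq_mul ?orbT.
    have -> : (u * p2.-1 * (v * p2.-1) * p = u * v * (p2.-1 * p2.-1 * p))%N by nia.
    have -> : (u * v * p.-1 * (p2 * p2) = u * v * (p2 * p2 * p.-1))%N by nia.
    by rewrite leq_mul2l k3 orbT.
  have := leq_mul k h; move: ratio.
  have -> : (u * (v * A) * (p.-1 * B') = u * v * p.-1 * (A * B'))%N by nia.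
  have -> : (u.-1 * (v.-1 * A') * (p * B) = u.-1 * v.-1 * p * (A' * B))%N by nia.
  lia.
have sU : size U = (size W').+1 by apply/eqP; rewrite eqn_leq UW UW2.
(* Without u, U matches W' in size, so its product of predecessors is at most that of W', and u - 1
   must pay for t (p - 1). This rules out u < p, and also t >= 2 since u <= p_2 < 2 p - 1. *)
have drop u : u \in U -> (t * p.-1 <= u.-1)%N.
  move=> uU'; have PU := perm_to_rem uU'.
  have sr : (size (rem u U) <= size W')%N by rewrite size_rem // sU.
  have ar : all (fun u => 1 < u <= p2)%N (rem u U).
    by apply/allP => v /mem_rem; exact: (allP aU).
  have := cmp _ ar sr; move: phi W'0; rewrite (perm_big _ PU) big_cons.
  move: (\prod_(v <- rem u U) v.-1)%N (\prod_(w <- W') w.-1)%N => A B ? B0 ?.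
  rewrite -(leq_pmul2r B0) -mulnA; apply: (@leq_trans (u.-1 * A)) => //.
  by rewrite leq_mul2l; apply/orP; right.
have U12 u : u \in U -> (u == p1) || (u == p2).
  move=> uU'; have := hU u uU'; have := drop u uU'; have := U1 u uU'.
  have : (p.-1 <= t * p.-1)%N by rewrite leq_pmull.
  lia.
have t1 : t = 1%N.
  case: U sU aU drop {U12 cmp phi big ratio uU U1 hU U0 UW UW2} => // u U _ /= /andP[/andP[u1 up] _].
  move/(_ u); rewrite inE eqxx => /(_ isT) h; nia.
rewrite {}t1 !mul1n in phi big drop.
have sU2 : (size U <= 2)%N.
  apply: (@uniq_leq_size _ U [:: p1; p2]) => // u /U12; by rewrite !inE.
(* A single u would be traded for p alone, which is smaller; so U is {p_1, p_2} and W is {p, r}. *)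
case: U sU sU2 uU U12 phi big {aU U0 ratio cmp drop U1 hU UW UW2} => [//|u [|v [|//]]] /= sU _ uU U12.
  case: W' sU {PW aW W'0} => //= _ _; rewrite !big_cons !big_nil.
  by have := U12 u; rewrite inE eqxx => /(_ isT); lia.
case: W' sU {PW aW W'0} => [//|r [|//]] _; rewrite !big_cons !big_nil !muln1 => phi big.
exists r; move: uU; rewrite andbT inE => uv.
have := U12 u; rewrite !inE eqxx => /(_ isT) hu.
have := U12 v; rewrite !inE eqxx orbT => /(_ isT) hv.
move: uv phi big; case/orP: hu => /eqP ->; case/orP: hv => /eqP ->; rewrite ?eqxx //.
  by move=> _ -> ->.
by move=> _ H1 H2; rewrite [(p1 * p2)%N]mulnC H2 [(p1.-1 * _)%N]mulnC H1.
Qed.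

(** * Maximality of Y_{p,2} for its totient value *)

Lemma next_primeP n : [/\ prime (next_prime n), (n < next_prime n)%N &
  forall q, prime q -> (n < q)%N -> (next_prime n <= q)%N].
Proof.
rewrite /next_prime; case: ex_minnP => q /andP[nq pq] hq; split=> // r pr nr.
by apply: hq; rewrite nr.
Qed.

Lemma next_prime_le (R : realType) (e : R) : 0 < e -> exists N, forall n, (N <= n)%N ->
  (next_prime n)%:R <= (1 + e) * n%:R.
Proof.
move=> e0; have [N hN] := prime_in_short_interval e0; exists N => n /hN[q [pq nq qe]].
have [_ _ /(_ q pq nq) h] := next_primeP n.
by apply: le_trans qe; rewrite ler_nat.
Qed.

Definition Y2_primes p := [seq q <- iota 0 (prime_after p 2).+1 | prime q && (q != p)].

Lemma Y2E p : Y2 p = (\prod_(q <- Y2_primes p) q)%N.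
Proof. by rewrite /Y2 big_filter -(big_mkord (fun q => prime q && (q != p)) id) /index_iota subn0. Qed.

Lemma Y2_primes_uniq p : uniq (Y2_primes p).
Proof. exact/filter_uniq/iota_uniq. Qed.

Lemma mem_Y2_primes p q :
  (q \in Y2_primes p) = [&& prime q, q != p & q <= prime_after p 2]%N.
Proof. by rewrite mem_filter mem_iota add0n ltnS -andbA. Qed.

(** The primes common to x and Y cancel from both inequalities, since x is t times its radical and Y
    is squarefree; [trade_primes] applies to the remaining U and W. *)
Lemma Y2_not_max p x : prime p -> (2 < p)%N -> (prime_after p 2 < p.*2.-1)%N ->
  (Y2 p < x)%N -> (totient x <= totient (Y2 p))%N ->
  exists r, (prime_after p 1 * prime_after p 2 < p * r)%N &&
    (p.-1 * r.-1 <= (prime_after p 1).-1 * (prime_after p 2).-1)%N.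
Proof.
move=> pp p3 p2p Yx phi.
have [pp1 lt1 min1] := next_primeP p.
have [pp2 lt2 min2] := next_primeP (next_prime p).
have x0 : (0 < x)%N by exact: leq_ltn_trans Yx.
have [t t0 [xE phiE]] := totient_radical x0.
set Z := Y2_primes p; set D := primes x in xE phiE.
pose U := [seq q <- Z | q \notin D]; pose W := [seq q <- D | q \notin Z].
pose I := [seq q <- Z | q \in D].
have uI : perm_eq [seq q <- D | q \in Z] I.
  apply: uniq_perm => [||q]; [exact/filter_uniq/primes_uniq|exact/filter_uniq/Y2_primes_uniq|].
  by rewrite !mem_filter andbC.
have ZE (F : nat -> nat) : (\prod_(q <- Z) F q = \prod_(q <- U) F q * \prod_(q <- I) F q)%N.
  by rewrite (bigID (fun q => q \notin D)) /= !big_filter; congr muln; apply: eq_bigl => q; rewrite negbK.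
have DE (F : nat -> nat) : (\prod_(q <- D) F q = \prod_(q <- W) F q * \prod_(q <- I) F q)%N.
  rewrite (bigID (fun q => q \notin Z)) /= -(perm_big _ uI) !big_filter; congr muln.
  by apply: eq_bigl => q; rewrite negbK.
have Zp q : q \in Z -> prime q by rewrite mem_Y2_primes => /and3P[].
have I0 F : {in Z, forall q, 0 < F q}%N -> (0 < \prod_(q <- I) F q)%N.
  by move=> hF; apply: prod_seq_gt0 => q; rewrite mem_filter => /andP[_ /hF].
apply: (@trade_primes p (prime_after p 1) (prime_after p 2) t U W) => //.
- by rewrite filter_uniq // Y2_primes_uniq.
- by rewrite filter_uniq // primes_uniq.
- by move=> u; rewrite mem_filter => /andP[_ /Zp/prime_gt1].
- move=> u; rewrite mem_filter mem_Y2_primes => /and4P[_ pu up u2].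
  have [//|pu'|E] := ltngtP u p; last by rewrite E eqxx in up.
  have := min1 u pu pu'; rewrite leq_eqVlt => /orP[/eqP <-|h1].
    by rewrite eqxx ?orbT.
  have uE : u = prime_after p 2.
    by apply/eqP; rewrite eqn_leq u2; exact: min2.
  by rewrite -uE eqxx ?orbT.
- move=> w; rewrite mem_filter mem_Y2_primes mem_primes => /andP[nw /and3P[pw _ _]].
  by move: nw; rewrite pw /= negb_and negbK -ltnNge.
- have i0 : (0 < \prod_(q <- I) q.-1)%N.
    by apply: I0 => q /Zp/prime_gt1; case: q => [|[]].
  move: phi; rewrite phiE Y2E totient_prod_primes ?Y2_primes_uniq //; last first.
    by apply/allP => q /Zp.
  by rewrite ZE DE mulnA leq_pmul2r.
have i0 : (0 < \prod_(q <- I) q)%N by apply: I0 => q /Zp/prime_gt0.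
by move: Yx; rewrite {1}xE Y2E ZE DE mulnA ltn_pmul2r.
Qed.

(** The witness is m = phi(Y): Y is admissible for this m and no larger integer is, so Y is the
    maximum described by [N1P]. *)
Lemma Y2_in_N1set p :
  (forall x, Y2 p < x -> totient (Y2 p) < totient x)%N -> N1set (Y2 p).
Proof.
move=> hmax.
have Y0 : (0 < Y2 p)%N.
  by rewrite Y2E; apply: prod_seq_gt0 => q; rewrite mem_Y2_primes => /andP[/prime_gt0].
have VY : V (totient (Y2 p)) by exists (Y2 p).
exists (totient (Y2 p)) => //; have [[N0 Nphi] Nmax] := N1P VY.
apply/eqP; rewrite eqn_leq Nmax ?andbT; last by split.
by rewrite leqNgt; apply/negP => /hmax; rewrite ltnNge Nphi.
Qed.

(** The phi inequality reads r <= p_1 p_2/p + (p_1 - p)(p_2 - p)/(p (p - 1)), and the last fraction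
    is below 1 - d. But an integer above X = p_1 p_2/p is at least floor(X) + 1 > X + 1 - d. *)
Lemma no_integer_above_frac (R : realType) (d : R) (p p1 p2 r : nat) : (1 < p)%N ->
  frac_part ((p1 * p2)%N%:R / p%:R) < d ->
  (p1%:R - p%:R) * (p2%:R - p%:R) < (1 - d) * (p%:R * (p%:R - 1)) ->
  (p1 * p2 < p * r)%N -> (0 < p1)%N -> (0 < p2)%N ->
  ~ (p.-1 * r.-1 <= p1.-1 * p2.-1)%N.
Proof.
move=> p1' fr gap big q1 q2 phi.
have p0 : 0 < p%:R :> R by rewrite ltr0n ltnW.
have pm1 : 0 < p%:R - 1 :> R by rewrite subr_gt0 ltr1n.
have r0 : (0 < r)%N by case: (r) big => //; rewrite muln0.
set X := (p1 * p2)%N%:R / p%:R in fr.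
have XE : X * p%:R = p1%:R * p2%:R by rewrite /X divfK ?gt_eqF // natrM.
have Xr : X < r%:R by rewrite /X ltr_pdivrMr // -natrM ltr_nat [(r * p)%N]mulnC.
have fl : (Num.floor X)%:~R + 1 <= r%:R :> R.
  have : (Num.floor X < r%:Z)%R by rewrite -(ltr_int R); apply: le_lt_trans (ge_floor X) Xr.
  by rewrite -lezD1 -(ler_int R) intrD.
have rX : X - d + 1 < r%:R by move: fr; rewrite /frac_part; lra.
have phiR : (p%:R - 1) * (r%:R - 1) <= (p1%:R - 1) * (p2%:R - 1) :> R.
  by move: phi; rewrite -(ler_nat R) !natrM -!subn1 !natrB // ltnW.
have k : p%:R * (p%:R - 1) * (X - d + 1) < p%:R * (p%:R - 1) * r%:R.
  by rewrite ltr_pM2l // mulr_gt0.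
have k2 : p%:R * ((p%:R - 1) * (r%:R - 1)) <= p%:R * ((p1%:R - 1) * (p2%:R - 1)) :> R.
  by rewrite ler_pM2l.
have k3 : p%:R * (p%:R - 1) * (X - d + 1) = (p%:R - 1) * (X * p%:R) + p%:R * (p%:R - 1) * (1 - d) by ring.
rewrite XE in k3; lra.
Qed.

Local Open Scope classical_set_scope.
Local Open Scope ring_scope.

Theorem theorem4 (R : realType) (delta0 : R)
    (delta0_gt0 : 0 < delta0) (delta0_lt1 : delta0 < 1) :
  infinite_set (frac_primes delta0) ->
  finite_set [set p | frac_primes delta0 p /\ ~ N1set (Y2 p)].
Proof.
(* For large p this gives p_1 - p <= e p and p_2 - p <= 3 e p, with product at most 3 e^2 p^2 < (1 -
   delta_0) p (p - 1) when p >= 4; also p_2 <= 13p/10 < 2 p - 1. *)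
move=> _; have [e [e0 e1]] : exists e : R, 0 < e /\ 10 * e = 1 - delta0.
  by exists ((1 - delta0) / 10); split; lra.
have [N hN] := next_prime_le e0.
apply: (@sub_finite_set _ _ `I_(maxn N 4)); last exact: finite_II.
move=> p [[pp fr] nY] /=; rewrite ltnNge geq_max; apply/negP => /andP[Np p4].
apply: nY; apply: Y2_in_N1set => x Yx; rewrite ltnNge; apply/negP => phi.
have [[_ lt1 _] [_ lt2 _]] := (next_primeP p, next_primeP (next_prime p)).
have h1 := hN p Np; have h2 := hN (next_prime p) (leq_trans Np (ltnW lt1)).
have [p1 P1E] : exists p1, prime_after p 1 = p1 by eexists.
have [p2 P2E] : exists p2, prime_after p 2 = p2 by eexists.
rewrite -[next_prime (next_prime p)]/(prime_after p 2) P2E in lt2 h2.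
rewrite -[next_prime p]/(prime_after p 1) P1E in lt1 lt2 h1 h2.
rewrite P1E P2E in fr.
have p4r : 4 <= p%:R :> R by rewrite ler_nat.
have l1 : p%:R < p1%:R :> R by rewrite ltr_nat.
have l2 : p1%:R < p2%:R :> R by rewrite ltr_nat.
have e10 : e <= 1 / 10 by lra.
have g1 : p1%:R - p%:R <= e * p%:R by lra.
have g2 : p2%:R - p%:R <= 3 * e * p%:R.
  have : e * p1%:R <= e * (2 * p%:R) by rewrite ler_pM2l //; nra.
  lra.
have p2p : (p2 < p.*2.-1)%N.
  suff : (p2.+1 < 2 * p)%N by clear; lia.
  by rewrite -(ltr_nat R) natrM -natr1; nra.
have [||r /andP[big phi']] := @Y2_not_max p x pp _ _ Yx phi; [exact: ltnW|by rewrite P2E|].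
rewrite P1E P2E in big phi'.
apply: (@no_integer_above_frac R delta0 p p1 p2 r) phi' => //; [exact: leq_trans p4| |exact: leq_trans lt1|exact: leq_trans lt2].
have : (p1%:R - p%:R) * (p2%:R - p%:R) <= (e * p%:R) * (3 * e * p%:R) by apply: ler_pM => //; lra.
rewrite -e1; nra.
Qed.
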